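(* Let $\Gamma$ be a countable linear group, let $\Gamma_{\rm fc}$ be its FC-center and let $K_\Gamma$ be the closure in $\mathrm{Aut}(\Gamma_{\rm fc})$ of $\mathrm{Ad}(\Gamma)|_{\Gamma_{\rm fc}}$. Then: (i) $\Gamma_{\rm fc}$ is a central group; (ii) $K_\Gamma$ coincides with $\mathrm{Ad}(\Gamma)|_{\Gamma_{\rm fc}}$ and is a finite group; (iii) the Plancherel measure of $\Gamma$ is the image of the Plancherel measure of $\Gamma_{\rm fc}$ under the map $\Phi: \mathrm{Ch}(\Gamma_{\rm fc}) \to \mathrm{Tr}(\Gamma)$ given by $$\Phi(t)=\frac{1}{\# \mathrm{Ad}(\Gamma)|_{\Gamma_{\rm fc}}}\sum_{s\in\mathrm{Ad}(\Gamma)|_{\Gamma_{\rm fc}}} \widetilde{t^s}.$$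
   Context: A linear group is a subgroup of $GL_n(\mathbf k)$ for some $n\geq 1$ and some field $\mathbf k$. A central group is a central extension of a finite group, i.e. a group whose center has finite index. The FC-center $\Gamma_{\rm fc}$ is the normal subgroup of elements of $\Gamma$ with finite $\Gamma$-conjugacy class. $\mathrm{Aut}(\Gamma_{\rm fc})$ carries the topology of pointwise convergence on $\Gamma_{\rm fc}$, and $\mathrm{Ad}(\Gamma)|_{\Gamma_{\rm fc}}$ is the group of automorphisms of $\Gamma_{\rm fc}$ given by conjugation by elements of $\Gamma$. For a countable group $\Lambda$: a trace on $\Lambda$ is a function $t:\Lambda\to\mathbf C$ of positive type (the matrix $(t(\gamma_j^{-1}\gamma_i))_{i,j}$ is positive semi-definite for all $\gamma_1,\dots,\gamma_n\in\Lambda$), constant on conjugacy classes, with $t(e)=1$. The set $\mathrm{Tr}(\Lambda)$ of traces is convex and compact metrizable for pointwise convergence; $\mathrm{Ch}(\Lambda)$ is the set of its extreme points (characters), a $G_\delta$ subset of $\mathrm{Tr}(\Lambda)$. The Plancherel measure of $\Lambda$ is the unique probability measure $\mu$ on $\mathrm{Ch}(\Lambda)$ such that $\|f\|_2^2=\int_{\mathrm{Ch}(\Lambda)}t(f^*\ast f)\,d\mu(t)$ for all $f\in\mathbf C[\Lambda]$, where $\|\cdot\|_2$ is the $\ell^2$-norm, $f^*(\gamma)=\overline{f(\gamma^{-1})}$, and $t$ is extended linearly to $\mathbf C[\Lambda]$ (existence and uniqueness are known). For $t\in\mathrm{Ch}(\Gamma_{\rm fc})$ and $s\in\mathrm{Aut}(\Gamma_{\rm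 fc})$, $t^s(\gamma)=t(s^{-1}(\gamma))$. For a function $t$ on a subgroup $H$ of $\Gamma$, $\widetilde t$ denotes its extension to $\Gamma$ by $0$ outside $H$. *)

(* Defs.v *)
From HB Require Import structures.
From mathcomp Require Import all_boot all_order all_algebra.
From mathcomp Require Import all_classical all_reals all_analysis.
From mathcomp Require Import finmap ring lra.
From mathcomp Require Import complex.

Set Implicit Arguments.
Unset Strict Implicit.
Unset Printing Implicit Defensive.

Import Order.TTheory GRing.Theory Num.Theory.
Import numFieldNormedType.Exports.

Local Open Scope classical_set_scope.
Local Open Scope ring_scope.

Definition GL (n : nat) (k : fieldType) : Type := {A : 'M[k]_n | A \in unitmx}.

Section GLGroup.
Variables (n : nat) (k : fieldType).

HB.instance Definition _ := Choice.on (GL n k).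

Definition GL_one : GL n k := Sub 1%:M (unitmx1 k n).

Definition GL_mul (A B : GL n k) : GL n k :=
  Sub (val A *m val B)
    (etrans (unitmx_mul (val A) (val B)) (introT andP (conj (valP A) (valP B)))).

Definition GL_inv (A : GL n k) : GL n k :=
  Sub (invmx (val A)) (etrans (unitmx_inv (val A)) (valP A)).

Fact GL_mulA : associative GL_mul.
Proof. by move=> A B C; apply: val_inj; rewrite /= mulmxA. Qed.

Fact GL_mul1 : left_id GL_one GL_mul.
Proof. by move=> A; apply: val_inj; rewrite /= mul1mx. Qed.

Fact GL_mulr1 : right_id GL_one GL_mul.
Proof. by move=> A; apply: val_inj; rewrite /= mulmx1. Qed.

Fact GL_mulV : left_inverse GL_one GL_inv GL_mul.
Proof. by move=> A; apply: val_inj; rewrite /= mulVmx // (valP A). Qed.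

Fact GL_mulrV : right_inverse GL_one GL_inv GL_mul.
Proof. by move=> A; apply: val_inj; rewrite /= mulmxV // (valP A). Qed.

HB.instance Definition _ :=
  isGroup.Build (GL n k) GL_mulA GL_mul1 GL_mulr1 GL_mulV GL_mulrV.

End GLGroup.

Definition linear_group (G : groupType) : Prop :=
  exists (n : nat) (k : fieldType) (rho : {multiplicative G -> GL n k}),
    (0 < n)%N /\ injective rho.

Definition center (G : groupType) : set G := [set z | forall g, commute z g].
Arguments center : clear implicits.

(* The index of a subgroup [H] is counted through its left cosets [g H]. *)
Definition finite_index (G : groupType) (H : set G) : Prop :=
  finite_set (range (fun g : G => [set (g * h)%g | h in H])).

Definition central_group (G : groupType) : Prop := finite_index (center G).

Definition conj_class (G : groupType) (x : G) : set G :=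
  range (fun g : G => (x ^ g)%g).

Definition fc (G : groupType) : set G := [set x | finite_set (conj_class x)].
Arguments fc : clear implicits.

Section FCCenter.
Variable G : groupType.

Fact fc_group_closed : group_closed (fun x : G => x \in fc G).
Proof.
split=> [|x y].
  apply/mem_set; apply: (@sub_finite_set _ _ [set 1%g]) => //.
  by move=> _ [g _ <-] /=; rewrite conj1g.
move=> /set_mem Fx /set_mem Fy; apply/mem_set.
have F := finite_image2 (fun a b : G => (a / b)%g) Fx Fy.
apply: sub_finite_set F => _ [g _ <-].
exists (x ^ g)%g; first by exists g.
by exists (y ^ g)%g; [exists g | rewrite conjMg conjVg].
Qed.

End FCCenter.

Definition fc_center (G : groupType) : Type := set_type (fc G).

HB.instance Definition _ (G : groupType) := SubChoice.on (fc_center G).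
HB.instance Definition _ (G : groupType) :=
  SubChoice_isSubGroup.Build G (fun x : G => x \in fc G) (fc_center G)
    (@fc_group_closed G).

Definition auts (L : groupType) : set {ptws L -> discrete_topology L} :=
  [set f : L -> L | bijective f /\ {morph f : x y / (x * y)%g}].
Arguments auts : clear implicits.

(* [L] is discrete, and [Aut L] gets the subspace topology. *)
Definition Aut (L : groupType) : Type := set_type (auts L).

HB.instance Definition _ (L : groupType) := Topological.on (Aut L).

Definition aut_fun (L : groupType) (s : Aut L) : L -> L := val s.
Coercion aut_fun : Aut >-> Funclass.

Section AutGroup.
Variable L : groupType.

Definition mk_aut (f : L -> L) (bf : bijective f)
    (mf : {morph f : x y / (x * y)%g}) : Aut L :=
  SigSub (mem_set (conj bf mf) : (f : {ptws L -> discrete_topology L}) \in auts L).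

Fact aut_bij (s : Aut L) : bijective s.
Proof. by have [] := set_mem (valP s). Qed.

Fact aut_morph (s : Aut L) : {morph s : x y / (x * y)%g}.
Proof. by have [] := set_mem (valP s). Qed.

Fact aut_ext (s t : Aut L) : s =1 t -> s = t.
Proof. by move=> /funext st; apply: val_inj. Qed.

Fact id_morph : {morph (id : L -> L) : x y / (x * y)%g}. Proof. by []. Qed.

Definition aut_one : Aut L := mk_aut (Bijective (frefl id) (frefl id)) id_morph.

Fact comp_aut_morph (s t : Aut L) : {morph s \o t : x y / (x * y)%g}.
Proof. by move=> x y /=; rewrite !aut_morph. Qed.

Definition aut_mul (s t : Aut L) : Aut L :=
  mk_aut (bij_comp (aut_bij s) (aut_bij t)) (@comp_aut_morph s t).

Definition aut_inv_fun (s : Aut L) (y : L) : L := xget 1%g [set x | s x = y].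

Fact aut_invK (s : Aut L) : cancel (aut_inv_fun s) s.
Proof.
move=> y; have [g _ gK] := aut_bij s.
by apply: (@xgetPex _ 1%g [set x | s x = y]); exists (g y).
Qed.

Fact autK (s : Aut L) : cancel s (aut_inv_fun s).
Proof. by move=> x; apply: (bij_inj (aut_bij s)); rewrite aut_invK. Qed.

Fact aut_inv_morph (s : Aut L) : {morph aut_inv_fun s : x y / (x * y)%g}.
Proof.
by move=> x y; apply: (bij_inj (aut_bij s)); rewrite aut_morph !aut_invK.
Qed.

Definition aut_inv (s : Aut L) : Aut L :=
  mk_aut (Bijective (@aut_invK s) (@autK s)) (@aut_inv_morph s).

Fact aut_mulA : associative aut_mul.
Proof. by move=> s t u; apply: aut_ext. Qed.

Fact aut_mul1 : left_id aut_one aut_mul.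
Proof. by move=> s; apply: aut_ext. Qed.

Fact aut_mulr1 : right_id aut_one aut_mul.
Proof. by move=> s; apply: aut_ext. Qed.

Fact aut_mulV : left_inverse aut_one aut_inv aut_mul.
Proof. by move=> s; apply: aut_ext => x; exact: autK. Qed.

Fact aut_mulrV : right_inverse aut_one aut_inv aut_mul.
Proof. by move=> s; apply: aut_ext => x; exact: aut_invK. Qed.

HB.instance Definition _ :=
  isGroup.Build (Aut L) aut_mulA aut_mul1 aut_mulr1 aut_mulV aut_mulrV.

End AutGroup.

Section Adjoint.
Variables (G : groupType).

Fact fc_conj (g : G) (x : fc_center G) : (g * val x * g^-1)%g \in fc G.
Proof.
apply/mem_set; have /set_mem Fx := valP x; apply: sub_finite_set Fx => _ [h _ <-].
by exists (g^-1 * h)%g => //; rewrite !conjgE !invgM invgK !mulgA.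
Qed.

Definition Ad_fun (g : G) (x : fc_center G) : fc_center G :=
  Sub (g * val x * g^-1)%g (fc_conj g x).

Fact Ad_fun_can (g h : G) : (h * g = 1)%g -> cancel (Ad_fun g) (Ad_fun h).
Proof.
move=> hg x; apply: val_inj; rewrite /= !mulgA hg mul1g -!mulgA.
by rewrite -invgM hg invg1 mulg1.
Qed.

Fact Ad_fun_bij (g : G) : bijective (Ad_fun g).
Proof. by exists (Ad_fun g^-1%g); apply: Ad_fun_can; rewrite ?mulVg ?mulgV. Qed.

Fact Ad_fun_morph (g : G) : {morph Ad_fun g : x y / (x * y)%g}.
Proof.
by move=> x y; apply: val_inj; rewrite /= -!mulgA mulKg.
Qed.

Definition Ad (g : G) : Aut (fc_center G) := mk_aut (Ad_fun_bij g) (@Ad_fun_morph g).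

Definition AdG : set (Aut (fc_center G)) := range Ad.

Definition KG : set (Aut (fc_center G)) := closure AdG.

End Adjoint.

Arguments AdG : clear implicits.
Arguments KG : clear implicits.

Section Traces.
Variables (R : realType) (L : groupType).

(* For a complex number [z], [0 <= z] means that [z] is real and nonnegative. *)
Definition positive_type (t : L -> R[i]) : Prop :=
  forall (n : nat) (g : 'I_n -> L) (c : 'I_n -> R[i]),
    0 <= \sum_i \sum_j (c i)^*%C * t ((g j)^-1 * g i)%g * c j.

Definition traces : set {ptws L -> R[i]^o} :=
  [set t : L -> R[i] | [/\ positive_type t,
     (forall x g : L, t (x ^ g)%g = t x) & t 1%g = 1]].

Definition characters : set {ptws L -> R[i]^o} :=
  [set t : L -> R[i] | traces t /\
     forall (t1 t2 : L -> R[i]) (a : R), traces t1 -> traces t2 -> 0 < a < 1 ->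
       (forall x, t x = a%:C%C * t1 x + (1 - a)%:C%C * t2 x) -> t1 = t2].

End Traces.

Arguments traces : clear implicits.
Arguments characters : clear implicits.

Definition Tr (R : realType) (L : groupType) : Type := set_type (traces R L).
Definition Ch (R : realType) (L : groupType) : Type := set_type (characters R L).

HB.instance Definition _ (R : realType) (L : groupType) :=
  Topological.on (Tr R L).
HB.instance Definition _ (R : realType) (L : groupType) :=
  Topological.on (Ch R L).

Definition tr_fun (R : realType) (L : groupType) (t : Tr R L) : L -> R[i] := val t.
Coercion tr_fun : Tr >-> Funclass.
Definition ch_fun (R : realType) (L : groupType) (t : Ch R L) : L -> R[i] := val t.
Coercion ch_fun : Ch >-> Funclass.

Fact Ch_trace (R : realType) (L : groupType) (t : Ch R L) :
  (val t : {ptws L -> R[i]^o}) \in traces R L.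
Proof. by apply/mem_set; have [] := set_mem (valP t). Qed.

Definition Ch_Tr (R : realType) (L : groupType) (t : Ch R L) : Tr R L :=
  SigSub (Ch_trace t).

(* Measurable types must be inhabited: the constant function [1] is a
   character. *)
Section Inhabited.
Variables (R : realType) (L : groupType).

Fact one_trace : traces R L (fun=> 1).
Proof.
split=> // n g c.
suff -> : \sum_i \sum_j (c i)^*%C * 1 * c j = `|\sum_i c i| ^+ 2.
  by rewrite exprn_ge0.
rewrite sqr_normc rmorph_sum mulrC big_distrl /=.
apply: eq_bigr => i _; rewrite big_distrr /=.
by apply: eq_bigr => j _; rewrite mulr1.
Qed.

Fact trace_ineq (t : L -> R[i]) (x : L) (z : R[i]) : traces R L t ->
  0 <= 1 + z^*%C * z + z * t x^-1%g + z^*%C * t x.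
Proof.
move=> [pt _ t1].
pose g (i : 'I_2) := if val i == 0%N then 1%g else x.
pose c (i : 'I_2) := if val i == 0%N then 1 else z.
have := pt 2 g c; rewrite !big_ord_recl !big_ord0 /g /c /=.
rewrite !invg1 !mul1g !mulg1 mulVg t1.
rewrite (_ : Complex 1 (- 0) = 1 :> R[i]) ?oppr0 //.
by congr (0 <= _); rewrite !addrA; ring.
Qed.

Fact trace_Re_le1 (t : L -> R[i]) (x : L) : traces R L t ->
  complex.Re (t x) <= 1 /\ (complex.Re (t x) = 1 -> t x = 1).
Proof.
move=> tt.
have A1 := trace_ineq x (- 1) tt.
have A2 := trace_ineq x (Complex 0 1) tt.
have A3 := trace_ineq x (Complex (- 1) (- complex.Im (t x))) tt.
move: A1 A2 A3; case: (t x) => p q; case: (t x^-1%g) => p' q' /=.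
rewrite !lecE /= => /andP[/eqP a1 b1] /andP[/eqP a2 b2] /andP[/eqP a3 b3].
split; first by lra.
move=> p1; subst p; congr Complex; nra.
Qed.

Fact one_character : characters R L (fun=> 1).
Proof.
split; first exact: one_trace.
move=> t1 t2 a T1 T2 /andP[a0 a1] e; apply/funext => x.
have [l1 u1] := trace_Re_le1 x T1; have [l2 u2] := trace_Re_le1 x T2.
have := congr1 (@complex.Re R) (e x).
move: l1 u1 l2 u2; case: (t1 x) => p q; case: (t2 x) => p' q' /= l1 u1 l2 u2 E.
by rewrite u1 ?u2 //; nra.
Qed.

HB.instance Definition _ :=
  isPointed.Build (Tr R L) (SigSub (mem_set one_trace)).
HB.instance Definition _ :=
  isPointed.Build (Ch R L) (SigSub (mem_set one_character)).

End Inhabited.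

Notation borel T := (g_sigma_algebraType (@open T)).

Section Plancherel.
Variables (R : realType) (L : groupType).

(* [C[L]] is the space of finitely supported functions.  In the three
   definitions below the sums are over the (finite) supports. *)
Definition group_algebra : set (L -> R[i]) :=
  [set f | finite_set [set x | f x != 0]].

Definition star (f : L -> R[i]) : L -> R[i] := fun x => (f x^-1%g)^*%C.

Definition convolution (f h : L -> R[i]) : L -> R[i] :=
  fun x => \sum_(y \in [set: L]) f y * h (y^-1 * x)%g.

Definition lin_ext (t : L -> R[i]) (f : L -> R[i]) : R[i] :=
  \sum_(x \in [set: L]) f x * t x.

Definition l2norm_sq (f : L -> R[i]) : R :=
  \sum_(x \in [set: L]) ComplexField.Normc.normc (f x) ^+ 2.

(* [t (f^* * f)] is real and nonnegative for a trace [t], so the integrand is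
   the real part of itself. *)
Definition plancherel_measure (mu : probability (borel (Ch R L)) R) : Prop :=
  forall f, group_algebra f ->
    (l2norm_sq f)%:E =
    (\int[mu]_t (complex.Re (lin_ext (t : Ch R L) (convolution (star f) f)))%:E)%E.

End Plancherel.

Definition ext0 (R : realType) (G : groupType) (t : fc_center G -> R[i]) :
    G -> R[i] :=
  fun x => if (insub x : option (fc_center G)) is Some y then t y else 0.

Definition twist (R : realType) (L : groupType) (t : L -> R[i]) (s : Aut L) :
    L -> R[i] :=
  fun x => t ((s^-1%g : Aut L) x).

(* Meaningful only when [AdG G] is finite. *)
Definition Phi_fun (R : realType) (G : groupType) (t : fc_center G -> R[i]) :
    G -> R[i] :=
  fun x => #|` fset_set (AdG G)|%:R^-1 *
    \sum_(s \in AdG G) ext0 (twist t s) x.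

(* Main.v *)
Require Import Defs.
From mathcomp Require Import all_boot all_order all_algebra.
From mathcomp Require Import all_classical all_reals all_analysis.
From mathcomp Require Import finmap ring lra complex.
From mathcomp Require Import measurable_realfun.

(** Write [L] for the FC-center of [G].

    The finiteness statements come from linear algebra.  Since [G] consists of
    [n]-by-[n] matrices, there are finitely many elements [y_1, ..., y_r] of [L]
    whose matrices span the linear span of all matrices of [L]
    ([finite_span]).  An automorphism [Ad g] of [L] is determined by the
    conjugates of the [y_i] under [g], and each [y_i] has only finitely many
    conjugates; so [Ad(G)] is finite ([linear_finite_AdG]).  The cosets of the
    center of [L] are the fibers of [y |-> Ad y], which gives (i), and finite
    sets are closed in the Hausdorff space [Aut L], which gives (ii).

    For (iii), the image of the Plancherel measure of [G] under the inclusion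
    of [Ch G] in [Tr G] and the image of the Plancherel measure of [L] under
    [Phi] are shown to have the same moments, that is, to give the same
    integral to every function [t |-> t x_1 * ... * t x_k].  As [G] is
    countable and traces are bounded by [1], a Borel probability measure on
    [Tr G] is determined by its moments ([eq_of_moments]).  The moments are
    computed in three steps.

    - The Plancherel formula for [delta_1 + c delta_x], with [x <> 1], says
      that the mean of [t x] is [0]; it is [1] for [x = 1]
      ([Rintegral_plancherel]).

    - If [x] has infinitely many conjugates, then [t x = 0] for almost every
      character [t] of [G]: [t x] is the value of [t] at the mean of [n]
      distinct conjugates of [x], whose squared 2-norm is [1/n]
      ([Rintegral_normsq]).  The function [Phi t] vanishes at such an [x] by
      construction.

    - If [x] lies in [L], let [z_x] be the mean of the [Ad(G)]-orbit of [x].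
      It is central in [C[G]] and in [C[L]], and a character is multiplicative
      on central elements, by extremality ([character_central]).  Now
      [t x = t z_x] for a character [t] of [G], and [Phi t x = t z_x] for a
      character [t] of [L].  Hence both moments at [x_1, ..., x_k] are the mean
      of [t (z_{x_1} ... z_{x_k})], which is the coefficient of [1] in
      [z_{x_1} ... z_{x_k}]: the same number for [L] and for [G]
      ([Plancherel_Phi_moments]). *)

Set Implicit Arguments.
Unset Strict Implicit.
Unset Printing Implicit Defensive.

Import Order.TTheory GRing.Theory Num.Theory.
Import numFieldNormedType.Exports.

Local Open Scope classical_set_scope.
Local Open Scope ring_scope.

(** * Functions of positive type *)

Section PositiveType.
Variables (R : realType) (L : groupType).
Implicit Types (t : L -> R[i]).

(** Positivity is stated for families indexed by an ordinal; products and other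
    finite index types are more convenient for combining two families. *)
Lemma positive_type_fin t (I : finType) (g : I -> L) (c : I -> R[i]) :
  positive_type t ->
  0 <= \sum_i \sum_j (c i)^*%C * t ((g j)^-1 * g i)%g * c j.
Proof.
move=> /(_ #|I| (fun k => g (enum_val k)) (fun k => c (enum_val k))).
suff -> : \sum_i \sum_j (c i)^*%C * t ((g j)^-1 * g i)%g * c j =
  \sum_(i < #|I|) \sum_(j < #|I|) (c (enum_val i))^*%C *
     t ((g (enum_val j))^-1 * g (enum_val i))%g * c (enum_val j) by [].
rewrite (reindex _ (onW_bij _ (@enum_val_bij I))) /=; apply: eq_bigr => i _.
by rewrite (reindex _ (onW_bij _ (@enum_val_bij I))).
Qed.

(** The quadratic form at the points [1] and [x] takes real values; its values
    at the coefficients [(1, 1)] and [(1, i)] force the two numbers to be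
    conjugate. *)
Lemma trace_inv t (x : L) : traces R L t -> t (x^-1)%g = (t x)^*%C.
Proof.
move=> [pt _ t1].
have key (z : R[i]) : 0 <= 1 + z^*%C * z + z * t x^-1%g + z^*%C * t x.
  pose g (i : bool) := if i then 1%g else x.
  pose c (i : bool) := if i then 1 else z.
  have := positive_type_fin g c pt; rewrite !big_bool /g /c /=.
  rewrite !invg1 !mul1g !mulg1 mulVg t1.
  rewrite (_ : Complex 1 (- 0) = 1 :> R[i]) ?oppr0 //.
  by congr (0 <= _); rewrite !addrA; ring.
move: (key 1) (key (Complex 0 1)).
case: (t x) => p q; case: (t x^-1%g) => p' q' /=.
rewrite !lecE /= => /andP[/eqP a1 b1] /andP[/eqP a2 b2].
by congr Complex; lra.
Qed.

(** The quadratic form at [1] and [x] is nonnegative at the coefficients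
    [(1, - t x)], where its value is [1 - |t x|^2]. *)
Lemma trace_sqr_le1 t (x : L) : traces R L t ->
  complex.Re (t x) ^+ 2 + complex.Im (t x) ^+ 2 <= 1.
Proof.
move=> tt; have := trace_ineq x (- t x) tt; rewrite trace_inv //.
case: (t x) => p q; rewrite lecE /= => /andP[_].
by rewrite !expr2; lra.
Qed.

Lemma trace_Re_bound t (x : L) : traces R L t -> `|complex.Re (t x)| <= 1.
Proof.
move=> /(trace_sqr_le1 x) h; rewrite -(@ler_pXn2r _ 2) ?nnegrE //.
by rewrite expr1n real_normK ?num_real //; have := sqr_ge0 (complex.Im (t x)); lra.
Qed.

Lemma trace_Im_bound t (x : L) : traces R L t -> `|complex.Im (t x)| <= 1.
Proof.
move=> /(trace_sqr_le1 x) h; rewrite -(@ler_pXn2r _ 2) ?nnegrE //.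
by rewrite expr1n real_normK ?num_real //; have := sqr_ge0 (complex.Re (t x)); lra.
Qed.

End PositiveType.

(** * Characters are multiplicative on central elements *)

Section CentralSums.
Variables (R : realType) (L : groupType).

(** This makes the sum of [us] a central element of the group algebra. *)
Definition conj_stable (us : seq L) : Prop :=
  forall g : L, perm_eq [seq (u ^ g)%g | u <- us] us.

Lemma big_conj_stable (V : nmodType) (us : seq L) (F : L -> V) (g : L) :
  conj_stable us -> \sum_(u <- us) F (u ^ g)%g = \sum_(u <- us) F u.
Proof. by move=> st; rewrite -[RHS](perm_big _ (st g)) /= big_map. Qed.

Variables (t : L -> R[i]) (us : seq L).
Hypotheses (tr_t : traces R L t) (us_st : conj_stable us).

(** This is [x |-> t (k x)], where [k = 4 N + h] is central and self-adjoint
    in the group algebra: [h] is the sum over the [N] entries [u] of [us] of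
    [w u] and its adjoint.  If [w] has modulus [1], then the operator norm of [h]
    is at most [2 N], so that [k] is positive and [t k > 0]. *)
Definition perturb (w : R[i]) (x : L) : R[i] :=
  \sum_(u <- us) (4%:R * t x + (w * t (u * x)%g + w^*%C * t (u^-1 * x)%g)).

(** As the sum of [us] is central, each [u] can be moved between [(g j)^-1] and
    [g i].  The contribution of [u] is then twice the form of [t] at the points
    [g i], plus the form of [t] at the points [g i] and [u g i] together with
    coefficients [c i] and [conj w * c i]. *)
Lemma perturb_positive_type (w : R[i]) :
  w * w^*%C = 1 -> positive_type (perturb w).
Proof.
move=> w1 n g c; have [pt _ _] := tr_t.
pose Q u i j := (c i)^*%C * (4%:R * t ((g j)^-1 * g i)%g +
  (w * t ((g j)^-1 * (u * g i))%g + w^*%C * t ((g j)^-1 * (u^-1 * g i))%g)) * c j.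
have -> : \sum_i \sum_j (c i)^*%C * perturb w ((g j)^-1 * g i)%g * c j =
    \sum_(u <- us) \sum_i \sum_j Q u i j.
  rewrite [RHS]exchange_big /=; apply: eq_bigr => i _.
  rewrite [RHS]exchange_big /=; apply: eq_bigr => j _.
  rewrite /perturb -(big_conj_stable _ (g j) us_st) mulr_sumr mulr_suml.
  apply: eq_bigr => u _; congr (_ * (_ + (_ * t _ + _ * t _)) * _).
    by rewrite conjgE !mulgA mulgK.
  by rewrite -conjVg conjgE !mulgA mulgK.
apply: sumr_ge0 => u _.
pose g2 (p : 'I_n * bool) := if p.2 then (u * g p.1)%g else g p.1.
pose c2 (p : 'I_n * bool) := if p.2 then w^*%C * c p.1 else c p.1.
have -> : \sum_i \sum_j Q u i j =
    2%:R * (\sum_i \sum_j (c i)^*%C * t ((g j)^-1 * g i)%g * c j)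
    + \sum_p \sum_q (c2 p)^*%C * t ((g2 q)^-1 * g2 p)%g * c2 q.
  rewrite mulr_sumr.
  have -> : \sum_p \sum_q (c2 p)^*%C * t ((g2 q)^-1 * g2 p)%g * c2 q =
    \sum_i \sum_j \sum_b \sum_b' (c2 (i, b))^*%C *
      t ((g2 (j, b'))^-1 * g2 (i, b))%g * c2 (j, b').
    under [RHS]eq_bigr do rewrite exchange_big.
    rewrite (pair_bigA _ (fun i b => \sum_j \sum_b' (c2 (i, b))^*%C *
      t ((g2 (j, b'))^-1 * g2 (i, b))%g * c2 (j, b'))) /=.
    apply: eq_bigr => -[i b] _.
    by rewrite pair_bigA; apply: eq_bigr => -[j b'] _.
  rewrite -big_split /=; apply: eq_bigr => i _.
  rewrite mulr_sumr -big_split /=; apply: eq_bigr => j _.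
  rewrite !big_bool /c2 /g2 /Q /= !rmorphM /= conjcK.
  rewrite !invgM !mulgA mulgVK.
  set a := t _; set b := t (_ * u * _)%g; set b' := t (_ * _ * _)%g.
  rewrite -[X in 2%:R * X]mulr1 -w1; move: w1.
  set z := w^*%C; move=> w1.
  by ring: w1.
apply: addr_ge0; last exact: positive_type_fin.
by apply: mulr_ge0; [rewrite ler0n | exact: pt].
Qed.

Lemma perturb_conj w x g : perturb w (x ^ g)%g = perturb w x.
Proof.
have [_ tc _] := tr_t.
rewrite /perturb -(big_conj_stable _ g us_st); apply: eq_bigr => u _.
by rewrite -conjVg -!conjMg !tc.
Qed.

Lemma perturb1 w : perturb w 1%g =
  (\sum_(u <- us) (4 + 2 * complex.Re (w * t u)))%:C%C.
Proof.
have [_ _ t1] := tr_t.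
rewrite rmorph_sum; apply: eq_bigr => u _ /=.
rewrite !mulg1 (trace_inv _ tr_t) t1.
rewrite -rmorphM /= addcJ rmorphD rmorphM mulr1 /=.
by congr (_ + _); rewrite ?rmorphM ?rmorph_nat.
Qed.

Lemma perturb_gt0 w : us != [::] -> w * w^*%C = 1 ->
  0 < \sum_(u <- us) (4 + 2 * complex.Re (w * t u)).
Proof.
move=> us0 w1.
have pos u : 0 < 4 + 2 * complex.Re (w * t u).
  have := trace_sqr_le1 u tr_t; move: w1; case: (w) => a b; case: (t u) => p q.
  move=> /(congr1 (@complex.Re R)) /= e h.
  by have := sqr_ge0 (a + p); have := sqr_ge0 (b - q); lra.
case: (us) us0 => [//|u s] _; rewrite big_cons ltr_pwDl //.
by apply: sumr_ge0 => v _; exact: ltW.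
Qed.

(** After normalization the perturbation is again a trace, so that [t] is a
    convex combination of the perturbations for [w] and [- w]. *)
Lemma perturb_trace w : us != [::] -> w * w^*%C = 1 ->
  traces R L (fun x => (\sum_(u <- us) (4 + 2 * complex.Re (w * t u)))^-1%:C%C
    * perturb w x).
Proof.
move=> us0 w1; have D0 := perturb_gt0 us0 w1; split.
- move=> n g c; have := perturb_positive_type w1 g c.
  set D := \sum_(u <- us) _ in D0 *; set S := (X in 0 <= X) => S0.
  rewrite (_ : \sum_i _ = D^-1%:C%C * S).
    by rewrite mulr_ge0 // ler0c invr_ge0 ltW.
  rewrite mulr_sumr; apply: eq_bigr => i _; rewrite mulr_sumr.
  by apply: eq_bigr => j _; ring.
- by move=> x g; rewrite perturb_conj.
- by rewrite perturb1 -rmorphM /= mulVf ?gt_eqF.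
Qed.

End CentralSums.

Section CharacterCentral.
Variables (R : realType) (L : groupType).

(** The perturbations for [w] and [- w] add up to [8 N t].  By extremality of
    [t], both are multiples of [t]. *)
Lemma character_perturb (t : L -> R[i]) (us : seq L) (w : R[i]) (x : L) :
  characters R L t -> conj_stable us -> w * w^*%C = 1 ->
  perturb t us w x = perturb t us w 1%g * t x.
Proof.
move=> [tt ext] st w1; have [us0|us0] := eqVneq us [::].
  by rewrite us0 /perturb !big_nil mul0r.
have Nw1 : - w * (- w)^*%C = 1 by rewrite rmorphN mulrNN.
have Dp := perturb_gt0 tt us0 w1; have Dn := perturb_gt0 tt us0 Nw1.
have Tp := perturb_trace tt st us0 w1; have Tn := perturb_trace tt st us0 Nw1.
rewrite perturb1 //.
set D := (\sum_(u <- us) (4 + 2 * complex.Re (w * t u))) in Dp Tp *.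
set D' := (\sum_(u <- us) (4 + 2 * complex.Re (- w * t u))) in Dn Tn *.
have sumD : D + D' = 8 * (size us)%:R.
  rewrite -big_split /= (eq_bigr (fun=> 8)) ?big_const_seq.
    by rewrite count_predT iter_addr_0 mulr_natr.
  by move=> u _; rewrite mulNr raddfN /=; lra.
have N0 : (size us)%:R != 0 :> R by rewrite pnatr_eq0 size_eq0.
have N0' : 0 < (size us)%:R :> R by rewrite lt0r N0 ler0n.
have eqT y : t y = (D / (8 * (size us)%:R))%:C%C * (D^-1%:C%C * perturb t us w y)
   + (1 - D / (8 * (size us)%:R))%:C%C * (D'^-1%:C%C * perturb t us (- w) y).
  have -> : 1 - D / (8 * (size us)%:R) = D' / (8 * (size us)%:R).
    by rewrite -sumD; field; rewrite sumD mulf_neq0 // pnatr_eq0.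
  have cancel (E : R) z : E != 0 ->
      (E / (8 * (size us)%:R))%:C%C * (E^-1%:C%C * z) =
      (8 * (size us)%:R)^-1%:C%C * z.
    by move=> E0; rewrite mulrA -rmorphM /= mulrAC divff // mul1r.
  rewrite !cancel ?gt_eqF // -mulrDr.
  have -> : perturb t us w y + perturb t us (- w) y =
      (8 * (size us)%:R)%:C%C * t y.
    rewrite -big_split /= (eq_bigr (fun=> 8%:R * t y)) ?big_const_seq.
      rewrite count_predT iter_addr_0 -mulrnAl rmorphM /= !rmorph_nat.
      by rewrite mulr_natr.
    by move=> u _; rewrite rmorphN; ring.
  by rewrite mulrA -rmorphM /= mulVf ?mul1r // mulf_neq0 // pnatr_eq0.
have D01 : 0 < D / (8 * (size us)%:R) < 1.
  rewrite divr_gt0 ?mulr_gt0 // ltr_pdivrMr ?mulr_gt0 // mul1r -sumD.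
  by rewrite ltrDl.
have e : D^-1%:C%C * perturb t us w x = t x.
  rewrite [RHS]eqT -(congr1 (fun f => f x) (ext _ _ _ Tp Tn D01 eqT)).
  by rewrite -mulrDl -rmorphD /= addrC subrK mul1r.
by rewrite -e mulrA -rmorphM /= divff ?gt_eqF // mul1r.
Qed.

(** [character_perturb] for [w = 1] and [w = i] settles the self-adjoint
    and the anti-self-adjoint part of the sum of [us]; adding the two gives twice
    the claim. *)
Lemma character_central (t : L -> R[i]) (us : seq L) (x : L) :
  characters R L t -> conj_stable us ->
  \sum_(u <- us) t (u * x)%g = (\sum_(u <- us) t u) * t x.
Proof.
move=> ch st; have [[_ _ t1] _] := ch.
have h w : w * w^*%C = 1 ->
    w * (\sum_(u <- us) t (u * x)%g) + w^*%C * (\sum_(u <- us) t (u^-1 * x)%g) =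
    (w * (\sum_(u <- us) t u) + w^*%C * (\sum_(u <- us) t (u^-1)%g)) * t x.
  move=> w1; have := character_perturb x ch st w1.
  rewrite /perturb !big_split /= -!mulr_sumr t1.
  have -> : \sum_(u <- us) t (u * 1)%g = \sum_(u <- us) t u.
    by apply: eq_bigr => u _; rewrite mulg1.
  have -> : \sum_(u <- us) t (u^-1 * 1)%g = \sum_(u <- us) t (u^-1)%g.
    by apply: eq_bigr => u _; rewrite mulg1.
  have -> : \sum_(u <- us) t x = (\sum_(u <- us) 1) * t x.
    by rewrite mulr_suml; under [in RHS]eq_bigr do rewrite mul1r.
  rewrite [RHS]mulrDl mulrA => e; exact: (addrI _ e).
move: (h 1) (h 'i%C); rewrite !rmorph1 !mul1r => /(_ erefl) e1.
have ii : 'i%C * 'i%C^*%C = 1 :> R[i].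
  by rewrite -sqr_normc normc_def /= expr0n expr1n add0r sqrtr1 expr1n.
have iN : 'i%C^*%C = - 'i%C :> R[i] by apply/eqP; rewrite eq_complex /= oppr0 !eqxx.
have i0 : 'i%C != 0 :> R[i].
  by apply/eqP => i0; move/eqP: ii; rewrite i0 mul0r eq_sym oner_eq0.
move=> /(_ ii); rewrite iN !mulNr -!mulrBr -mulrA => /(mulfI i0) e2.
apply: (@mulfI _ 2%:R); first by rewrite pnatr_eq0.
transitivity (\sum_(u <- us) t (u * x)%g + \sum_(u <- us) t (u^-1 * x)%g
  + (\sum_(u <- us) t (u * x)%g - \sum_(u <- us) t (u^-1 * x)%g)); first by ring.
by rewrite e1 e2; ring.
Qed.
End CharacterCentral.

(** * Finiteness of the adjoint group *)

Section AdFinite.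
Variable G : groupType.

(** Commutation with a fixed element extends from a set of matrices to its
    linear span; this is the form in which equality of [Ad g] and [Ad h] is
    tested. *)
Lemma conj_eqP (g h y : G) :
  (g * y * g^-1 = h * y * h^-1)%g <-> commute (h^-1 * g)%g y.
Proof.
split=> [e|].
  have gy : (g * y = h * y * h^-1 * g)%g by rewrite -e mulgVK.
  by rewrite /commute -mulgA gy !mulgA mulVg mul1g.
rewrite /commute => e.
have -> : (g * y = h * y * h^-1 * g)%g.
  by rewrite -[RHS]mulgA -[RHS]mulgA -e !mulgA mulgV mul1g.
by rewrite mulgK.
Qed.

Lemma Ad_eqP (g h : G) :
  Ad g = Ad h <-> forall x : fc_center G, commute (h^-1 * g)%g (val x).
Proof.
split=> [e x|c]; last by apply: aut_ext => x; apply: val_inj; exact/conj_eqP/c.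
exact/conj_eqP/(congr1 val (congr1 (fun s : Aut _ => s x) e)).
Qed.

Lemma finite_Ad_orbits (s : seq (fc_center G)) :
  finite_set (range (fun g => [seq Ad g y | y <- s])).
Proof.
elim: s => [|y s IHs].
  by apply: (@sub_finite_set _ _ [set [::]]) => // _ [g _ <-].
have Fy : finite_set (range (fun g => Ad g y)).
  have Fx : finite_set (conj_class (val y)) by exact: (set_mem (valP y)).
  apply: sub_finite_set (finite_image (insubd y) Fx) => _ [g _ <-].
  exists (val (Ad g y)); last by rewrite valKd.
  by exists (g^-1)%g; rewrite //= conjgE invgK mulgA.
apply: sub_finite_set (finite_image2 cons Fy IHs) => _ [g _ <-] /=.
by exists (Ad g y); [exists g | exists [seq Ad g z | z <- s]; [exists g|]].
Qed.

(** A free subfamily of maximal length spans; lengths are bounded by the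
    dimension of [V]. *)
Lemma finite_span (k : fieldType) (V : vectType k) (T : Type) (M : T -> V) :
  exists s : seq T, forall x, M x \in <<[seq M y | y <- s]>>%VS.
Proof.
pose P m := `[< exists s : seq T, size s = m /\ free [seq M y | y <- s] >].
have exP : exists m, P m.
  by exists 0%N; apply/asboolP; exists [::]; rewrite nil_free.
have ubP m : P m -> (m <= \dim {:V})%N.
  move=> /asboolP[s [<- /eqP fs]]; rewrite -(size_map M) -fs.
  by apply: dimvS; exact: subvf.
have [m /asboolP[s [sz fs]] mmax] := ex_maxnP exP ubP.
exists s => x; apply: contraT => nx.
have /mmax : P m.+1.
  apply/asboolP; exists (x :: s); rewrite /= sz; split=> //.
  by rewrite free_cons nx.
by rewrite ltnn.
Qed.

(** [Ad g] is determined by its values on a finite family of elements of the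
    FC-center whose matrices span those of the whole FC-center, and these values
    lie in finitely many finite conjugacy classes. *)
Lemma linear_finite_AdG : linear_group G -> finite_set (AdG G).
Proof.
move=> [n [k [rho [_ rho_inj]]]].
pose M (x : G) : 'M[k]_n := val (rho x).
have MM x y : M (x * y)%g = M x *m M y by rewrite /M gmulfM.
have Minj : injective M by move=> x y /val_inj; exact: rho_inj.
have [s sP] := finite_span (fun x : fc_center G => M (val x)).
have sAd g h : [seq Ad g y | y <- s] = [seq Ad h y | y <- s] -> Ad g = Ad h.
  move=> e; apply/Ad_eqP => x; apply: Minj; rewrite MM [RHS]MM.
  have cs i : M (h^-1 * g)%g *m [seq M (val y) | y <- s]`_i =
              [seq M (val y) | y <- s]`_i *m M (h^-1 * g)%g.
    have [si|si] := ltnP i (size s); last first.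
      by rewrite nth_default ?size_map // mulmx0 mul0mx.
    rewrite (nth_map 1%g) // -!MM; congr M.
    have /(congr1 (fun l => nth 1%g l i)) := e; rewrite !(nth_map 1%g) //.
    by move=> /(congr1 val) /= /conj_eqP.
  rewrite (coord_span (X := in_tuple _) (sP x)) mulmx_sumr mulmx_suml.
  by apply: eq_bigr => i _; rewrite -scalemxAr -scalemxAl; rewrite cs.
pose F l := xget 1%g [set a : Aut (fc_center G) |
  AdG G a /\ [seq a y | y <- s] = l].
apply: sub_finite_set (finite_image F (finite_Ad_orbits s)) => _ [g _ <-].
exists [seq Ad g y | y <- s]; first by exists g.
have [[h _ eh] e] := @xgetPex _ 1%g [set a : Aut (fc_center G) |
  AdG G a /\ [seq a y | y <- s] = [seq Ad g y | y <- s]]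
  (ex_intro _ (Ad g) (conj (ex_intro2 _ _ g I erefl) erefl)).
by rewrite /F -eh; apply: sAd; rewrite eh.
Qed.

Lemma AdM (g h : G) : (Ad g * Ad h)%g = Ad (g * h)%g.
Proof.
by apply: aut_ext => x; apply: val_inj; rewrite /= invgM !mulgA.
Qed.

Lemma Ad1 : Ad (1 : G)%g = 1%g.
Proof. by apply: aut_ext => x; apply: val_inj; rewrite /= mul1g invg1 mulg1. Qed.

Lemma AdV (g : G) : ((Ad g)^-1 = Ad g^-1)%g.
Proof. by apply: (mulgI (Ad g)); rewrite mulgV AdM mulgV Ad1. Qed.

Lemma AdG_group_closed : group_closed (fun s => s \in AdG G).
Proof.
split; first by apply/mem_set; exists 1%g => //; exact: Ad1.
move=> _ _ /set_mem[g _ <-] /set_mem[h _ <-]; apply/mem_set.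
by exists (g / h)%g => //; rewrite AdV AdM.
Qed.

(** The coset of [x] modulo the center is the fiber of [y |-> Ad y] through
    [x]. *)
Lemma central_fc_center : finite_set (AdG G) -> central_group (fc_center G).
Proof.
move=> fA; rewrite /central_group /finite_index.
apply: sub_finite_set (finite_image (fun a => [set y | Ad (val y) = a]) fA).
move=> _ [x _ <-]; exists (Ad (val x)); first by exists (val x).
apply/seteqP; split=> [y /= /Ad_eqP c|_ [z cz <-] /=].
  exists (x^-1 * y)%g; last by rewrite mulVKg.
  by move=> u; apply: val_inj; exact: c.
by apply/Ad_eqP => u; rewrite /= mulKg; have /(congr1 val) := cz u.
Qed.

Lemma Aut_eval_continuous (L : groupType) (x : L) :
  continuous (fun s : Aut L => (aut_fun s x : discrete_topology L)).
Proof.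
move=> s; apply: (@continuous_comp _ _ _
  (val : Aut L -> {ptws L -> discrete_topology L})
  (fun f : {ptws L -> discrete_topology L} => f x)).
  exact: initial_continuous.
exact: (@proj_continuous _ (fun _ => discrete_topology L) x).
Qed.

(** Two automorphisms that differ at [x] are separated by the value at [x],
    which depends continuously on the automorphism. *)
Lemma Aut_accessible (L : groupType) : accessible_space (Aut L).
Proof.
move=> s u su.
have [x sux] : exists x, aut_fun s x <> aut_fun u x.
  apply: contrapT => h; move/eqP: su; apply; apply: aut_ext => x.
  by apply: contrapT => ?; apply: h; exists x.
exists [set v : Aut L | aut_fun v x = aut_fun s x]; split; last 2 first.
- exact/mem_set.
- by apply/mem_set => /= e; apply: sux.
- have /continuousP/(_ [set aut_fun s x] (discrete_open _)) :=
    @Aut_eval_continuous L x.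
  by [].
Qed.

Lemma KG_finite : finite_set (AdG G) -> KG G = AdG G.
Proof.
move=> fA; rewrite /KG; apply/esym/closure_id.
exact: (accessible_finite_set_closed.1 (@Aut_accessible _)).
Qed.

End AdFinite.

(** * Extension by zero and the map Phi *)

Section ExtensionByZero.
Variables (R : realType) (G : groupType).
Implicit Types phi : fc_center G -> R[i].

Lemma ext0_in phi (y : fc_center G) : ext0 phi (val y) = phi y.
Proof. by rewrite /ext0 valK. Qed.

Lemma ext0_out phi (x : G) : x \notin fc G -> ext0 phi x = 0.
Proof. by move=> nx; rewrite /ext0 insubN. Qed.

(** The matrix of [ext0 phi] at the points [g i] is block diagonal for the
    partition of the points into left cosets of the FC-center.  Inside a coset
    with representative [r], the entries are those of the matrix of [phi] at the
    points [r^-1 * g i]. *)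
Lemma ext0_positive_type phi : positive_type phi -> positive_type (ext0 phi).
Proof.
move=> pphi n g c.
have fM := group_closedM (fc_group_closed G).
have fV := group_closedV (fc_group_closed G).
pose rel (i j : 'I_n) := ((g j)^-1 * g i)%g \in fc G.
have relxx i : rel i i by rewrite /rel mulVg; exact: (fc_group_closed G).1.
have relC i j : rel i j -> rel j i.
  by move=> /fV; rewrite /rel invgM invgK.
have relT i j k : rel i j -> rel j k -> rel i k.
  by move=> ij jk; have := fM _ _ jk ij; rewrite mulgA mulgK.
(* [pick] depends on the class of [i] only, so [rho] selects one index per coset *)
pose rho i := odflt i [pick j | rel i j].
have rhoP i : rel i (rho i).
  by rewrite /rho; case: pickP => [j //|/(_ i)]; rewrite relxx.
have rhoE i j : rel i j -> rho i = rho j.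
  move=> ij; rewrite /rho.
  have -> : [pick k | rel i k] = [pick k | rel j k].
    apply: eq_pick => k; apply/idP/idP; apply: relT => //; exact: relC.
  by case: pickP => // /(_ j); rewrite relxx.
pose l k i : fc_center G := insubd 1%g ((g k)^-1 * g i)%g.
pose d k i := if rho i == k then c i else 0.
rewrite (_ : \sum_i _ = \sum_k \sum_i \sum_j
    (d k i)^*%C * phi ((l k j)^-1 * l k i)%g * d k j).
  by apply: sumr_ge0 => k _; exact: pphi.
rewrite [RHS]exchange_big; apply: eq_bigr => i _ /=.
rewrite [RHS]exchange_big; apply: eq_bigr => j _ /=.
rewrite (bigD1 (rho i)) //= big1 ?addr0 => [|k /negPf ki]; last first.
  by rewrite /d eq_sym ki rmorph0 !mul0r.
rewrite /d eqxx; have [ij|nij] := eqVneq (rho j) (rho i).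
  rewrite -ext0_in; congr (_ * ext0 _ _ * _) => /=.
  have rj := rhoP j; rewrite ij in rj.
  have vl m : rel m (rho i) -> val (l (rho i) m) = ((g (rho i))^-1 * g m)%g.
    by move=> r; rewrite /l insubdK.
  by rewrite [RHS]/= !vl // invgM invgK mulgA mulgK.
rewrite ext0_out ?mulr0 ?mul0r //.
by apply: contra nij => /rhoE ->.
Qed.

End ExtensionByZero.

Section Phi.
Variables (R : realType) (G : groupType).
Hypothesis finA : finite_set (AdG G).
Implicit Types t : fc_center G -> R[i].

Definition Ad_seq : seq (Aut (fc_center G)) := fset_set (AdG G).

(** The [Ad(G)]-orbit of [y], each point being repeated as many times as the order
    of its stabilizer. *)
Definition Ad_orbit (y : fc_center G) : seq (fc_center G) :=
  [seq aut_fun s y | s <- Ad_seq].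

Lemma mem_Ad_seq s : (s \in Ad_seq) = (s \in AdG G).
Proof. by rewrite /Ad_seq in_fset_set. Qed.

Lemma Ad_seq_uniq : uniq Ad_seq. Proof. exact: fset_uniq. Qed.

Lemma size_Ad_seq_neq0 : (size Ad_seq)%:R != 0 :> R[i].
Proof.
rewrite pnatr_eq0 size_eq0; apply/eqP => e.
have : 1%g \in Ad_seq by rewrite mem_Ad_seq; exact: (AdG_group_closed G).1.
by rewrite e.
Qed.

(** Injective self-maps of the finite group [Ad(G)] are permutations; this is
    applied to translations and to inversion. *)
Lemma perm_Ad_seq (f : Aut (fc_center G) -> Aut (fc_center G)) :
  injective f -> (forall s, s \in AdG G -> f s \in AdG G) ->
  perm_eq [seq f s | s <- Ad_seq] Ad_seq.
Proof.
move=> f_inj fA; have uf : uniq [seq f s | s <- Ad_seq].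
  by rewrite map_inj_uniq // Ad_seq_uniq.
have sub : {subset [seq f s | s <- Ad_seq] <= Ad_seq}.
  by move=> _ /mapP[s + ->]; rewrite !mem_Ad_seq; exact: fA.
have le_size : (size Ad_seq <= size [seq f s | s <- Ad_seq])%N.
  by rewrite size_map.
exact: uniq_perm uf Ad_seq_uniq (uniq_min_size uf sub le_size).2.
Qed.

Lemma Ad_in g : Ad g \in AdG G. Proof. by apply/mem_set; exists g. Qed.

Lemma Ad_orbit_Ad g y : perm_eq (Ad_orbit (Ad g y)) (Ad_orbit y).
Proof.
have -> : Ad_orbit (Ad g y) =
    [seq aut_fun s y | s <- [seq (s * Ad g)%g | s <- Ad_seq]].
  by rewrite -map_comp.
apply: perm_map; apply: perm_Ad_seq; first exact: mulIg.
by move=> s sA; exact: group_closedM (AdG_group_closed G) _ _ sA (Ad_in g).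
Qed.

Lemma map_Ad_orbit g y : perm_eq [seq Ad g z | z <- Ad_orbit y] (Ad_orbit y).
Proof.
have -> : [seq Ad g z | z <- Ad_orbit y] =
    [seq aut_fun s y | s <- [seq (Ad g * s)%g | s <- Ad_seq]].
  by rewrite -!map_comp.
apply: perm_map; apply: perm_Ad_seq; first exact: mulgI.
by move=> s sA; exact: group_closedM (AdG_group_closed G) _ _ (Ad_in g) sA.
Qed.

Definition Ad_average t (y : fc_center G) : R[i] :=
  (size Ad_seq)%:R^-1 * \sum_(z <- Ad_orbit y) t z.

(** The inverse in the definition of [twist] disappears in the sum over the
    group [Ad(G)]. *)
Lemma Phi_funE t : Phi_fun t = ext0 (Ad_average t).
Proof.
apply/funext => x; rewrite /Phi_fun fsbig_finite //=.
have [xF|xF] := boolP (x \in fc G); last first.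
  by rewrite !ext0_out // big1 ?mulr0 // => s _; rewrite ext0_out.
rewrite -[x](@insubdK _ _ (fc_center G) 1%g x) //; set y := insubd _ x.
rewrite ext0_in /Ad_average /Ad_orbit big_map; congr (_ * _).
rewrite -(perm_big _ (perm_Ad_seq (@invg_inj _)
  (group_closedV (AdG_group_closed G)))) big_map; apply: eq_bigr => s _.
by rewrite ext0_in /twist invgK.
Qed.

Lemma Phi_fun_out t x : x \notin fc G -> Phi_fun t x = 0.
Proof. by move=> nx; rewrite Phi_funE ext0_out. Qed.

Lemma Phi_fun_in t (y : fc_center G) : Phi_fun t (val y) = Ad_average t y.
Proof. by rewrite Phi_funE ext0_in. Qed.

Lemma Ad_average_positive_type t :
  positive_type t -> positive_type (Ad_average t).
Proof.
move=> pt n g c.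
rewrite (_ : \sum_i _ = (size Ad_seq)%:R^-1 * \sum_(s <- Ad_seq) \sum_i \sum_j
   (c i)^*%C * t ((aut_fun s (g j))^-1 * aut_fun s (g i))%g * c j).
  by rewrite mulr_ge0 ?invr_ge0 ?ler0n //; apply: sumr_ge0 => s _; exact: pt.
rewrite [X in _ = _ * X]exchange_big mulr_sumr; apply: eq_bigr => i _ /=.
rewrite [X in _ = _ * X]exchange_big mulr_sumr; apply: eq_bigr => j _ /=.
rewrite /Ad_average big_map mulrCA !mulr_sumr mulr_suml; apply: eq_bigr => s _.
rewrite aut_morph -!mulrA; congr (_ * (_ * (t (_ * _)%g * _))).
apply: (mulgI (aut_fun s (g j))); rewrite -aut_morph !mulgV.
by apply: (mulgI (aut_fun s 1%g)); rewrite -aut_morph !mulg1.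
Qed.

Lemma Phi_fun_trace t : traces R (fc_center G) t -> traces R G (Phi_fun t).
Proof.
move=> [pt tc t1]; split.
- by rewrite Phi_funE; apply/ext0_positive_type/Ad_average_positive_type.
- move=> x g; have [xF|xF] := boolP (x \in fc G); last first.
    rewrite !Phi_fun_out //; apply: contra xF => xgF.
    have -> : x = (g * val (Sub (x ^ g)%g xgF : fc_center G) * g^-1)%g.
      by rewrite /= conjgE !mulgA mulgV mul1g mulgK.
    exact: fc_conj.
  have -> : (x ^ g)%g = val (Ad g^-1 (Sub x xF : fc_center G)).
    by rewrite /= conjgE invgK mulgA.
  rewrite -[x in RHS]/(val (Sub x xF : fc_center G)) !Phi_fun_in.
  by rewrite /Ad_average (perm_big _ (Ad_orbit_Ad _ _)).
rewrite -[1%g]/(val (1%g : fc_center G)) Phi_fun_in /Ad_average /Ad_orbit big_map.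
rewrite (eq_bigr (fun=> 1)) ?big_const_seq => [|s _].
  by rewrite count_predT iter_addr_0 mulVf // size_Ad_seq_neq0.
rewrite -t1; congr t.
by apply: (mulgI (aut_fun s 1%g)); rewrite -aut_morph !mulg1.
Qed.

End Phi.

(** * The Borel sets of the space of traces *)

Section Coordinates.
Variables (R : realType) (L : groupType).

Lemma contractive_continuous (f : R[i] -> R) :
  (forall z w, `|f z - f w|%:C%C <= `|z - w|) ->
  continuous (fun z : R[i]^o => f z).
Proof.
move=> fc z A /nbhs_ballP[e /= e0 zA]; apply/nbhs_ballP; exists e%:C%C => /=.
  by rewrite ltcR.
move=> w; rewrite -ball_normE /= => zw; apply: zA; rewrite -ball_normE /=.
by rewrite -ltcR; apply: le_lt_trans zw; exact: fc.
Qed.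

(** The four functions [Re], [- Re], [Im], [- Im]; with the opposites
    included, every open half-plane bounded by a line parallel to an axis has the
    form [a < coordR k z]. *)
Definition coordR (k : bool * bool) (z : R[i]) : R :=
  (if k.2 then -%R else id) ((if k.1 then @complex.Im R else @complex.Re R) z).

Lemma coordR_continuous k : continuous (fun z : R[i]^o => coordR k z).
Proof.
apply: contractive_continuous => z w; case: z => a b; case: w => c d.
rewrite normc_def /= lecR; set n2 := (X in Num.sqrt X).
have key u v : n2 = u ^+ 2 + v ^+ 2 -> `|u| <= Num.sqrt n2.
  by move=> ->; rewrite -sqrtr_sqr ler_wsqrtr // lerDl sqr_ge0.
case: k => -[] []; rewrite /coordR /=.
- by apply: (key _ (a - c)); rewrite /n2; ring.
- by apply: (key _ (a - c)); rewrite /n2; ring.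
- by apply: (key _ (b - d)); rewrite /n2; ring.
- by apply: (key _ (b - d)); rewrite /n2; ring.
Qed.

Lemma proj_ptws_continuous (x : L) :
  continuous (fun f : {ptws L -> R[i]^o} => f x).
Proof. exact: (@proj_continuous _ (fun _ => R[i]^o) x). Qed.

Lemma coord_continuous (A : set {ptws L -> R[i]^o}) x k :
  continuous (fun t : set_type A => coordR k ((val t : L -> R[i]) x)).
Proof.
move=> t; apply: (@continuous_comp _ _ _
  (fun t : set_type A => ((val t : L -> R[i]) x : R[i]^o)));
  last exact: coordR_continuous.
apply: (@continuous_comp _ _ _ (val : set_type A -> {ptws L -> R[i]^o})
  (fun f : {ptws L -> R[i]^o} => f x)); first exact: initial_continuous.
exact: proj_ptws_continuous.
Qed.

End Coordinates.

Lemma continuous_borel_measurable (R : realType) (T : ptopologicalType)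
  (f : T -> R) : continuous f -> measurable_fun setT (f : borel T -> R).
Proof.
move=> /continuousP cf; apply: (measurability _ (RGenOInfty.measurableE R)) => //.
move=> _ [_ [a ->] <-]; rewrite setTI; apply: sub_sigma_algebra.
by apply: cf; exact: interval_open.
Qed.

Section BorelTraces.
Variables (R : realType) (L : groupType).

Definition halfspaces : set (set (Tr R L)) :=
  [set B | exists (x : L) (k : bool * bool) (a : R),
    B = [set t : Tr R L | a < coordR k (t x)]].

Lemma cvg_ptws (F : set_system (L -> R[i])) (f : L -> R[i]) : Filter F ->
  (forall x, (fun g => g x) @ F --> (f x : R[i]^o)) ->
  F --> (f : {ptws L -> R[i]^o}).
Proof.
move=> FF Ff; apply/cvg_sup => x A /=.
case=> B [[C oC <-] Cf] BA; apply: filterS BA _.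
by apply: (Ff x); exact: open_nbhs_nbhs.
Qed.

Definition box (l : seq (L * (bool * bool) * rat)) : set (L -> R[i]) :=
  [set f | forall p, p \in l -> ratr p.2 < coordR p.1.2 (f p.1.1)].

Lemma coordR_close (z : R[i]) (e : R) : 0 < e ->
  (forall k, coordR k z < e / 2) -> `|z| < e%:C%C.
Proof.
move=> e0 h.
have := (h (false, false), h (false, true), h (true, false), h (true, true)).
case: z {h} => a b; rewrite /coordR /= => -[[[h1 h2] h3] h4].
rewrite normc_def ltcR /= -[X in _ < X](ger0_norm (ltW e0)) -sqrtr_sqr.
by rewrite ltr_sqrt ?exprn_gt0 //; nra.
Qed.

(** The sets containing a rational box around [f] form a filter that converges
    pointwise to [f], hence converges to [f] in the topology of pointwise
    convergence. *)
Lemma box_nbhs (f : L -> R[i]) (A : set {ptws L -> R[i]^o}) :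
  nbhs (f : {ptws L -> R[i]^o}) A -> exists l, box l f /\ box l `<=` A.
Proof.
pose F : set_system (L -> R[i]) := [set A | exists l, box l f /\ box l `<=` A].
suff : F --> (f : {ptws L -> R[i]^o}) by move=> h /h.
have FF : Filter F.
  split.
  - by exists [::].
  - move=> P Q [l1 [b1 s1]] [l2 [b2 s2]]; exists (l1 ++ l2); split.
      by move=> p; rewrite mem_cat => /orP[/b1|/b2].
    by move=> g bg; split; [apply: s1|apply: s2] => p pl; apply: bg;
      rewrite mem_cat pl ?orbT.
  - by move=> P Q PQ [l [b s]]; exists l; split=> // g /s /PQ.
apply: cvg_ptws => x B /nbhs_ballP[[e e'] /=].
rewrite ltcE /= => /andP[/eqP e00 e0]; rewrite e00 => eB.
have q k : {q : rat | coordR k (f x) - e / 2 < ratr q < coordR k (f x)}.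
  apply: cid; have [|q] :=
    @rat_in_itvoo R (coordR k (f x) - e / 2) (coordR k (f x)).
    by lra.
  by rewrite in_itv /= => qI; exists q.
pose ks := [:: (false, false); (false, true); (true, false); (true, true)].
exists [seq (x, k, sval (q k)) | k <- ks].
split.
  by move=> _ /mapP[k _ ->] /=; case: (q k) => r /= /andP[].
move=> g bg; apply: eB; rewrite -ball_normE /=.
apply: coordR_close => // k.
have /bg /= : (x, k, sval (q k)) \in [seq (x, k, sval (q k)) | k <- ks].
  by apply: map_f; case: k => -[] [].
case: (q k) => r /= /andP[r1 _].
have -> : coordR k (f x - g x) = coordR k (f x) - coordR k (g x).
  case: (f x) => a b; case: (g x) => c d.
  by case: (k) => -[] []; rewrite /coordR /=; ring.
lra.
Qed.

(** An open set is the union of the rational boxes that it contains, and there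
    are countably many rational boxes since [L] is countable. *)
Lemma open_Tr_halfspaces : countable [set: L] ->
  @open (Tr R L) `<=` <<s halfspaces >>.
Proof.
move=> /countable_injP[f finj] U oU.
pose e n : L := xget 1%g [set x | f x = n].
have eK x : e (f x) = x.
  have ek : f (e (f x)) = f x :=
    @xgetPex _ 1%g [set y | f y = f x] (ex_intro _ x erefl).
  by apply: finj ek; exact: mem_setT.
pose b (l : seq (nat * (bool * bool) * rat)) : set (Tr R L) :=
  [set t | box [seq (e p.1.1, p.1.2, p.2) | p <- l] (t : L -> R[i])].
have -> : U = \bigcup_(l in [set: seq (nat * (bool * bool) * rat)])
   (if `[< b l `<=` U >] then b l else set0).
  apply/seteqP; split=> [t Ut|t [l _]]; last first.
    by case: ifPn => [/asboolP|//]; exact.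
  have [V oV VU] := oU.
  have /box_nbhs[l [lt lV]] : nbhs (val t : {ptws L -> R[i]^o}) V.
    by apply: open_nbhs_nbhs; split=> //; move: Ut; rewrite -VU.
  have el : l = [seq (e p.1.1, p.1.2, p.2) | p <-
      [seq (f p.1.1, p.1.2, p.2) | p <- l]].
    by rewrite -map_comp -[LHS]map_id; apply: eq_map => -[[x k] r] /=; rewrite eK.
  exists [seq (f p.1.1, p.1.2, p.2) | p <- l] => //.
  rewrite asboolT; first by rewrite /b -el.
  by move=> u; rewrite /b -el /= => /lV; rewrite -VU.
apply: (@countable_bigcupT_measurable _ (g_sigma_algebraType halfspaces)).
  exact: countableP.
move=> l; case: ifPn => _; last exact: measurable0.
elim: l => [|p l IHl].
  rewrite (_ : b [::] = setT); first exact: measurableT.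
  by apply/seteqP; split.
rewrite (_ : b (p :: l) =
    [set t : Tr R L | ratr p.2 < coordR p.1.2 (t (e p.1.1))] `&` b l).
  apply: (@measurableI _ (g_sigma_algebraType halfspaces)) => //.
  by apply: sub_sigma_algebra; exists (e p.1.1), p.1.2, (ratr p.2).
apply/seteqP; split=> [t h|t [h1 h2] q] /=.
  split; first by apply: (h (e p.1.1, p.1.2, p.2)); rewrite /= mem_head.
  by move=> q ql; apply: h; rewrite /= inE ql orbT.
by rewrite inE => /orP[/eqP->|/h2].
Qed.

Lemma measurable_fun_Tr d (X : measurableType d) (f : X -> Tr R L) :
  countable [set: L] ->
  (forall x k, measurable_fun setT (fun w => coordR k (f w x))) ->
  measurable_fun setT (f : X -> borel (Tr R L)).
Proof.
move=> cL mf; apply: (@measurability _ _ X (borel (Tr R L)) setT f halfspaces).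
  apply/seteqP; split; apply: smallest_sub; do ?exact: smallest_sigma_algebra.
    exact: open_Tr_halfspaces.
  move=> _ [x [k [a ->]]]; apply: sub_sigma_algebra.
  have /continuousP/(_ `]a, +oo[%classic) :=
    @coord_continuous R L (traces R L) x k.
  rewrite preimage_itvoy; apply; exact: interval_open.
move=> _ [_ [x [k [a ->]]] <-].
have := mf x k measurableT `]a, +oo[%classic (measurable_itv _).
by rewrite !setTI preimage_itvoy.
Qed.

End BorelTraces.

(** * Bounded measurable functions and polynomial approximation of the sign *)

Section BoundedMeasurable.
Context d (X : measurableType d) (R : realType).

Definition bounded_mfun (g : X -> R) : Prop :=
  measurable_fun setT g /\ exists M, forall u, `|g u| <= M.

Lemma bounded_mfun_cst a : bounded_mfun (fun=> a).
Proof. by split; [exact: measurable_cst | exists `|a|]. Qed.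

Lemma bounded_mfunD g h :
  bounded_mfun g -> bounded_mfun h -> bounded_mfun (fun u => g u + h u).
Proof.
move=> [mg [M gM]] [mh [N hN]]; split; first exact: measurable_funD.
by exists (M + N) => u; rewrite (le_trans (ler_normD _ _)) ?lerD.
Qed.

Lemma bounded_mfunM g h :
  bounded_mfun g -> bounded_mfun h -> bounded_mfun (fun u => g u * h u).
Proof.
move=> [mg [M gM]] [mh [N hN]]; split; first exact: measurable_funM.
by exists (M * N) => u; rewrite normrM ler_pM.
Qed.

Lemma bounded_mfunZ a g : bounded_mfun g -> bounded_mfun (fun u => a * g u).
Proof. by move=> bg; apply: bounded_mfunM => //; exact: bounded_mfun_cst. Qed.

Lemma bounded_mfunN g : bounded_mfun g -> bounded_mfun (fun u => - g u).
Proof.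
move=> /(bounded_mfunZ (- 1)); congr bounded_mfun; apply/funext => u; exact: mulN1r.
Qed.

Lemma bounded_mfun_sum (I : Type) (r : seq I) (g : I -> X -> R) :
  (forall i, bounded_mfun (g i)) -> bounded_mfun (fun u => \sum_(i <- r) g i u).
Proof.
move=> bg; elim: r => [|i r IHr].
  by under eq_fun do rewrite big_nil; exact: bounded_mfun_cst.
by under eq_fun do rewrite big_cons; exact: bounded_mfunD.
Qed.

Lemma bounded_mfun_integrable (P : probability X R) g :
  bounded_mfun g -> P.-integrable setT (EFin \o g).
Proof.
move=> [mg [M gM]]; apply: measurable_bounded_integrable => //.
  by rewrite -ge0_fin_numE // fin_num_measure.
exists M; split; first exact: num_real.
by move=> N MN u _; rewrite /= (le_trans (gM u)) // ltW.
Qed.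

(** Real and imaginary parts are treated separately, so that only real-valued
    functions are integrated. *)
Definition bounded_mfunC (F : X -> R[i]) : Prop :=
  bounded_mfun (fun u => complex.Re (F u)) /\ bounded_mfun (fun u => complex.Im (F u)).

Lemma bounded_mfunC_cst a : bounded_mfunC (fun=> a).
Proof. by split; exact: bounded_mfun_cst. Qed.

Lemma bounded_mfunCD F H :
  bounded_mfunC F -> bounded_mfunC H -> bounded_mfunC (fun u => F u + H u).
Proof.
move=> [bF bF'] [bH bH']; split.
  by under eq_fun do rewrite raddfD; exact: bounded_mfunD.
by under eq_fun do rewrite raddfD; exact: bounded_mfunD.
Qed.

Lemma bounded_mfunCM F H :
  bounded_mfunC F -> bounded_mfunC H -> bounded_mfunC (fun u => F u * H u).
Proof.
move=> [bF bF'] [bH bH']; split.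
  have -> : (fun u => complex.Re (F u * H u)) = (fun u =>
      complex.Re (F u) * complex.Re (H u) + - (complex.Im (F u) * complex.Im (H u))).
    by apply/funext => u; case: (F u) => a b; case: (H u).
  by apply: bounded_mfunD; [|apply: bounded_mfunN]; exact: bounded_mfunM.
have -> : (fun u => complex.Im (F u * H u)) = (fun u =>
    complex.Re (F u) * complex.Im (H u) + complex.Im (F u) * complex.Re (H u)).
  by apply/funext => u; case: (F u) => a b; case: (H u).
by apply: bounded_mfunD; exact: bounded_mfunM.
Qed.

Lemma bounded_mfunC_sum (I : Type) (r : seq I) (F : I -> X -> R[i]) :
  (forall i, bounded_mfunC (F i)) -> bounded_mfunC (fun u => \sum_(i <- r) F i u).
Proof.
move=> bF; elim: r => [|i r IHr].
  by under eq_fun do rewrite big_nil; exact: bounded_mfunC_cst.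
by under eq_fun do rewrite big_cons; exact: bounded_mfunCD.
Qed.

Lemma bounded_mfunC_prod (I : Type) (r : seq I) (F : I -> X -> R[i]) :
  (forall i, bounded_mfunC (F i)) -> bounded_mfunC (fun u => \prod_(i <- r) F i u).
Proof.
move=> bF; elim: r => [|i r IHr].
  by under eq_fun do rewrite big_nil; exact: bounded_mfunC_cst.
by under eq_fun do rewrite big_cons; exact: bounded_mfunCM.
Qed.

Lemma Rintegral_bounded_mfun_sum (P : probability X R) (I : Type) (r : seq I)
    (g : I -> X -> R) : (forall i, bounded_mfun (g i)) ->
  (\int[P]_u (\sum_(i <- r) g i u))%R = \sum_(i <- r) (\int[P]_u g i u)%R.
Proof.
move=> bg; elim: r => [|i r IHr].
  rewrite big_nil; under eq_Rintegral do rewrite big_nil.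
  by rewrite Rintegral_cst // mul0r.
rewrite big_cons; under eq_Rintegral do rewrite big_cons.
rewrite RintegralD ?IHr //; apply: bounded_mfun_integrable => //.
exact: bounded_mfun_sum.
Qed.

End BoundedMeasurable.

Section SignIterates.
Variable R : realType.

(** An odd map of the interval from [-1] to [1] to itself, with fixed points
    [-1], [0] and [1], of which [-1] and [1] are attracting: its iterates are
    polynomials that converge pointwise on this interval to the sign function. *)
Definition cubic (v : R) : R := (3 * v - v ^+ 3) / 2.

Lemma cubicN v : cubic (- v) = - cubic v.
Proof. by rewrite /cubic; field. Qed.

Lemma iter_cubicN n v : iter n cubic (- v) = - iter n cubic v.
Proof. by elim: n => //= n ->; rewrite cubicN. Qed.

Lemma iter_cubic_itv n v : 0 <= v <= 1 -> v <= iter n cubic v <= 1.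
Proof.
move=> /andP[v0 v1]; elim: n => [|n /andP[IH1 IH2]] /=; first by rewrite lexx.
set w := iter n cubic v in IH1 IH2 *; rewrite /cubic; apply/andP; split.
  suff : 0 <= w * (1 - w) * (1 + w) by nra.
  by rewrite !mulr_ge0 //; lra.
suff : 0 <= (1 - w) ^+ 2 * (w + 2) by nra.
by rewrite mulr_ge0 ?sqr_ge0 //; lra.
Qed.

Lemma iter_cubic_norm n v : `|v| <= 1 -> `|iter n cubic v| <= 1.
Proof.
have pos w : 0 <= w -> `|w| <= 1 -> `|iter n cubic w| <= 1.
  move=> w0; rewrite ger0_norm // => w1.
  have /andP[h1 h2] : w <= iter n cubic w <= 1.
    by apply: iter_cubic_itv; rewrite w0.
  by rewrite ger0_norm // (le_trans w0).
have [v0|v0] := leP 0 v; first exact: pos.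
by rewrite -normrN => /pos; rewrite iter_cubicN normrN; apply; rewrite oppr_ge0 ltW.
Qed.

(** For [0 < w <= 1], the distance of the iterates to [1] is multiplied at each
    step by at most [1 - w / 2], because the iterates stay between [w] and [1]. *)
Lemma iter_cubic_cvg v : `|v| <= 1 -> (fun n => iter n cubic v) @ \oo --> Num.sg v.
Proof.
have pos w : 0 < w <= 1 -> (fun n => iter n cubic w) @ \oo --> (1 : R).
  move=> /andP[w0 w1].
  have bd n : 1 - iter n cubic w <= (1 - w / 2) ^+ n.
    elim: n => [|n IHn]; first by rewrite /= expr0; lra.
    have /andP[h1 h2] : w <= iter n cubic w <= 1 by apply: iter_cubic_itv; lra.
    rewrite exprSr /=; set u := iter n cubic w in IHn h1 h2 *.
    apply: le_trans (_ : (1 - u) * (1 - w / 2) <= _); last first.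
      by rewrite ler_wpM2r //; lra.
    rewrite -subr_ge0 /cubic.
    have -> : (1 - u) * (1 - w / 2) - (1 - (3 * u - u ^+ 3) / 2) =
       (1 - u) * (u ^+ 2 + (u - w)) / 2 by field.
    apply: divr_ge0 => //; apply: mulr_ge0; first lra.
    by apply: addr_ge0; [exact: sqr_ge0 | lra].
  apply: (@squeeze_cvgr _ _ _ _ (fun n => 1 - (1 - w / 2) ^+ n) (fun=> 1)).
  - apply: nearW => n; have := bd n.
    have /andP[_ h2] : w <= iter n cubic w <= 1 by apply: iter_cubic_itv; lra.
    by move=> h; apply/andP; split=> //; lra.
  - rewrite -[X in _ --> X]subr0; apply: cvgB; first exact: cvg_cst.
    by apply: cvg_expr; rewrite ger0_norm; lra.
  - exact: cvg_cst.
case: (ltrgt0P v) => v0.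
- by rewrite gtr0_sg // => v1; apply: pos; rewrite v0.
- rewrite ltr0_sg // => v1.
  have -> : (fun n => iter n cubic v) = (fun n => - iter n cubic (- v)).
    by apply/funext => n; rewrite iter_cubicN opprK.
  by apply: cvgN; apply: pos; rewrite oppr_gt0 v0.
- move=> _; rewrite v0 sgr0.
  have -> : (fun n => iter n cubic 0) = (fun=> 0); last exact: cvg_cst.
  by apply/funext; elim=> //= n ->; rewrite /cubic expr0n /= mulr0 subr0 mul0r.
Qed.

End SignIterates.

(** * The method of moments on the space of traces *)

Section Polynomials.
Variables (R : realType) (L : groupType).


Definition word_val (t : L -> R[i]) (w : seq L) : R[i] := \prod_(x <- w) t x.

Definition poly_val (t : L -> R[i]) (s : seq (R[i] * seq L)) : R[i] :=
  \sum_(p <- s) p.1 * word_val t p.2.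

(** Real-valued functions on [Tr L] that are complex polynomials in the
    evaluations [t |-> t x].  As [t x^-1] is the conjugate of [t x], these include
    the real and imaginary parts of the evaluations. *)
Definition is_poly (g : Tr R L -> R) : Prop :=
  exists s, forall t : Tr R L, (g t)%:C%C = poly_val t s.

Lemma is_poly_cst a : is_poly (fun=> a).
Proof.
by exists [:: (a%:C%C, [::])] => t; rewrite /poly_val big_seq1 /word_val big_nil mulr1.
Qed.

Lemma is_polyD g h : is_poly g -> is_poly h -> is_poly (fun t => g t + h t).
Proof.
move=> [s gs] [r hr]; exists (s ++ r) => t.
by rewrite rmorphD /= gs hr /poly_val big_cat.
Qed.

Lemma is_polyM g h : is_poly g -> is_poly h -> is_poly (fun t => g t * h t).
Proof.
move=> [s gs] [r hr].
exists [seq (p.1 * q.1, p.2 ++ q.2) | p <- s, q <- r] => t.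
rewrite rmorphM /= gs hr /poly_val big_allpairs_dep mulr_suml.
apply: eq_bigr => p _; rewrite mulr_sumr; apply: eq_bigr => q _ /=.
by rewrite /word_val big_cat /=; ring.
Qed.

Lemma is_polyZ a g : is_poly g -> is_poly (fun t => a * g t).
Proof. by move=> pg; apply: is_polyM => //; exact: is_poly_cst. Qed.

Lemma Tr_trace (t : Tr R L) : traces R L t.
Proof. exact: (set_mem (valP t)). Qed.

Lemma is_poly_coord x k : is_poly (fun t : Tr R L => coordR k (t x)).
Proof.
have pRe : is_poly (fun t : Tr R L => complex.Re (t x)).
  exists [:: (2^-1, [:: x]); (2^-1, [:: x^-1%g])] => t.
  rewrite /poly_val !big_cons big_nil /word_val !big_seq1 /=.
  rewrite (trace_inv _ (Tr_trace t)) ReJ_add addr0 -mulrDr mulrC.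
  by [].
have pIm : is_poly (fun t : Tr R L => complex.Im (t x)).
  exists [:: (- (2^-1 * 'i%C), [:: x]); (2^-1 * 'i%C, [:: x^-1%g])] => t.
  rewrite /poly_val !big_cons big_nil /word_val !big_seq1 /=.
  by rewrite (trace_inv _ (Tr_trace t)) ImJ_sub; ring.
have N g : is_poly g -> is_poly (fun t => - g t).
  move=> /(is_polyZ (- 1)); congr is_poly.
  by apply/funext => t; rewrite mulN1r.
by case: k => -[] []; [exact: N | | exact: N |].
Qed.

Lemma coord_bound (t : Tr R L) x k : `|coordR k (t x)| <= 1.
Proof.
by case: k => -[] []; rewrite /coordR /= ?normrN;
  (exact: (trace_Re_bound _ (Tr_trace t)) || exact: (trace_Im_bound _ (Tr_trace t))).
Qed.

(** Sets whose indicator function is a bounded pointwise limit of polynomials: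
    dominated convergence computes their measure from the moments.  They are
    stable under intersection, so they form a pi-system. *)
Definition approximable (B : set (Tr R L)) : Prop :=
  exists p : nat -> Tr R L -> R,
    [/\ forall n, is_poly (p n), forall n t, `|p n t| <= 1
      & forall t, (fun n => p n t) @ \oo --> (\1_B t : R)].

Lemma approximableT : approximable setT.
Proof.
exists (fun _ _ => 1); split=> [n|n t|t]; first exact: is_poly_cst.
  by rewrite normr1.
by rewrite indicT; exact: cvg_cst.
Qed.

Lemma approximableI A B :
  approximable A -> approximable B -> approximable (A `&` B).
Proof.
move=> [p [pp p1 pA]] [q [qp q1 qB]]; exists (fun n t => p n t * q n t).
split=> [n|n t|t]; first exact: is_polyM.
  by rewrite normrM mulr_ile1.
by rewrite indicI; apply: cvgM.
Qed.

(** The indicator of [0 < v] is [(s + s^2) / 2] for the sign [s] of [v], and the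
    sign is the limit of the iterates of [cubic]. *)
Lemma approximable_gt0 g : is_poly g -> (forall t, `|g t| <= 1) ->
  approximable [set t | 0 < g t].
Proof.
move=> pg g1; pose s n t := iter n (@cubic R) (g t).
have ps n : is_poly (s n).
  elim: n => // n IHn; rewrite /s /= /cubic.
  have -> : (fun t => (3 * iter n (@cubic R) (g t)
        - iter n (@cubic R) (g t) ^+ 3) / 2) =
     (fun t => 3 / 2 * s n t + (- 2^-1) * (s n t * (s n t * s n t))).
    by apply/funext => t; rewrite /s; set u := iter _ _ _; field.
  by apply: is_polyD; apply: is_polyZ => //; do 2?apply: is_polyM.
have s1 n t : `|s n t| <= 1 by exact: iter_cubic_norm.
exists (fun n t => 2^-1 * (s n t + s n t * s n t)); split=> [n|n t|t].
- by apply: is_polyZ; apply: is_polyD => //; exact: is_polyM.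
- rewrite normrM ger0_norm // ler_pdivrMl // mulr1.
  rewrite (le_trans (ler_normD _ _)) // -[2]/(1 + 1) lerD // normrM.
  by rewrite mulr_ile1.
- have sg := iter_cubic_cvg (g1 t).
  have -> : \1_[set t | 0 < g t] t =
      2^-1 * (Num.sg (g t) + Num.sg (g t) * Num.sg (g t)) :> R.
    rewrite indicE; case: (ltrgt0P (g t)) => h.
    + by rewrite mem_set //= gtr0_sg //; lra.
    + rewrite memNset ?ltr0_sg //=; first by ring.
      by move=> /=; rewrite ltNge ltW.
    + rewrite memNset /= ?h ?sgr0 ?ltxx //; first by ring.
  by apply: cvgM; [exact: cvg_cst | apply: cvgD => //; exact: cvgM].
Qed.

(** Half-spaces are defined by the positivity of [coordR k (t x) - a], which
    division by [1 + |a|] brings between [-1] and [1]. *)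
Lemma approximable_halfspace B : halfspaces B -> approximable B.
Proof.
move=> [x [k [a ->]]].
have a1 : 0 < 1 + `|a| by rewrite ltr_pwDl.
have -> : [set t : Tr R L | a < coordR k (t x)] =
    [set t | 0 < (1 + `|a|)^-1 * (coordR k ((t : Tr R L) x) + - a)].
  by apply/seteqP; split=> t /=; rewrite pmulr_rgt0 ?invr_gt0 // subr_gt0.
apply: approximable_gt0.
  apply: is_polyZ; apply: is_polyD; [exact: is_poly_coord | exact: is_poly_cst].
move=> t; rewrite normrM normfV (gtr0_norm a1) ler_pdivrMl // mulr1.
rewrite (le_trans (ler_normB _ _)) // lerD //; exact: coord_bound.
Qed.

End Polynomials.

Section Moments.
Context (R : realType) (L : groupType).
Context d1 d2 (X : measurableType d1) (Y : measurableType d2).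
Variables (P : probability X R) (Q : probability Y R).
Variables (f : X -> Tr R L) (h : Y -> Tr R L).
Hypothesis countL : countable [set: L].
Hypothesis mf : forall x k, measurable_fun setT (fun u => coordR k (f u x)).
Hypothesis mh : forall x k, measurable_fun setT (fun v => coordR k (h v x)).

Lemma bounded_mfunC_Tr d (Z : measurableType d) (e : Z -> Tr R L) x :
  (forall x k, measurable_fun setT (fun u => coordR k (e u x))) ->
  bounded_mfunC (fun u => e u x).
Proof.
move=> me; split.
  split; first exact: (me x (false, false)).
  by exists 1 => u; exact: (trace_Re_bound _ (Tr_trace _)).
split; first exact: (me x (true, false)).
by exists 1 => u; exact: (trace_Im_bound _ (Tr_trace _)).
Qed.

Lemma bounded_mfunC_word d (Z : measurableType d) (e : Z -> Tr R L) c w :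
  (forall x k, measurable_fun setT (fun u => coordR k (e u x))) ->
  bounded_mfunC (fun u => c * word_val (e u) w).
Proof.
move=> me; apply: bounded_mfunCM; first exact: bounded_mfunC_cst.
by apply: bounded_mfunC_prod => x; exact: bounded_mfunC_Tr.
Qed.

Lemma Rintegral_poly d (Z : measurableType d) (S : probability Z R)
    (e : Z -> Tr R L) s :
  (forall x k, measurable_fun setT (fun u => coordR k (e u x))) ->
  (\int[S]_u complex.Re (poly_val (e u) s))%R =
  \sum_(p <- s) (\int[S]_u complex.Re (p.1 * word_val (e u) p.2))%R.
Proof.
move=> me; rewrite -Rintegral_bounded_mfun_sum; last first.
  by move=> p; have [] := bounded_mfunC_word p.1 p.2 me.
by apply: eq_Rintegral => u _; rewrite raddf_sum.
Qed.

Hypothesis moments : forall c w,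
  (\int[P]_u complex.Re (c * word_val (f u) w))%R =
  (\int[Q]_v complex.Re (c * word_val (h v) w))%R.

Lemma moments_poly g : is_poly g ->
  (\int[P]_u g (f u))%R = (\int[Q]_v g (h v))%R.
Proof.
move=> [s gs].
have gE t : g t = complex.Re (poly_val t s) by rewrite -gs.
under eq_Rintegral do rewrite gE.
under [RHS]eq_Rintegral do rewrite gE.
by rewrite !Rintegral_poly //; apply: eq_bigr => p _; exact: moments.
Qed.

Lemma bounded_mfun_poly d (Z : measurableType d) (e : Z -> Tr R L) g :
  (forall x k, measurable_fun setT (fun u => coordR k (e u x))) ->
  is_poly g -> bounded_mfun (fun u => g (e u)).
Proof.
move=> me [s gs].
have -> : (fun u => g (e u)) = (fun u => complex.Re (poly_val (e u) s)).
  by apply/funext => u; rewrite -gs.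
by have [] : bounded_mfunC (fun u => poly_val (e u) s)
  by apply: bounded_mfunC_sum => p; exact: bounded_mfunC_word.
Qed.

Lemma approximable_cvg d (Z : measurableType d) (S : probability Z R)
    (e : Z -> Tr R L) (B : set (Tr R L)) (p : nat -> Tr R L -> R) :
  (forall x k, measurable_fun setT (fun u => coordR k (e u x))) ->
  measurable (B : set (borel (Tr R L))) ->
  (forall n, is_poly (p n)) -> (forall n t, `|p n t| <= 1) ->
  (forall t, (fun n => p n t) @ \oo --> (\1_B t : R)) ->
  (fun n => \int[S]_u (p n (e u))%:E)%E @ \oo --> S (e @^-1` B).
Proof.
move=> me mB pp p1 pB.
have mE : measurable_fun setT (e : Z -> borel (Tr R L)) by exact: measurable_fun_Tr.
have meB : measurable (e @^-1` B) by rewrite -[X in measurable X]setTI; exact: mE.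
have <- : (\int[S]_u (\1_(e @^-1` B) u)%:E)%E = S (e @^-1` B).
  by rewrite integral_indic // setIT.
have [] // := @dominated_convergence _ _ _ S setT measurableT
  (fun n u => (p n (e u))%:E) (fun u => (\1_(e @^-1` B) u)%:E) (fun=> 1%E).
- move=> n; apply/measurable_EFinP; exact: (bounded_mfun_poly me (pp n)).1.
- by apply/measurable_EFinP; exact: measurable_indic.
- apply: aeW => u _; apply: cvg_EFin; first exact: nearW.
  exact: pB.
- exact: (bounded_mfun_integrable S (bounded_mfun_cst _ 1)).
- by apply: aeW => u n _; rewrite lee_fin.
Qed.

(** The measurable approximable sets form a pi-system that contains the
    half-spaces, hence generates the Borel sets; the two image measures agree on
    it by passing to the limit in [moments_poly]. *)
Lemma eq_of_moments (B : set (borel (Tr R L))) : measurable B ->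
  P (f @^-1` B) = Q (h @^-1` B).
Proof.
move=> mB.
have mF : measurable_fun setT (f : X -> borel (Tr R L)) by exact: measurable_fun_Tr.
have mH : measurable_fun setT (h : Y -> borel (Tr R L)) by exact: measurable_fun_Tr.
pose F : {mfun X >-> borel (Tr R L)} := mfun_Sub (mem_set mF).
pose H : {mfun Y >-> borel (Tr R L)} := mfun_Sub (mem_set mH).
pose G : set (set (borel (Tr R L))) := [set C : set (borel (Tr R L)) |
  measurable C /\ approximable (C : set (Tr R L))].
apply: (@g_sigma_algebra_measure_unique _ R _ G _ (fun=> setT) _ _
  (distribution P F) (distribution Q H)).
- by move=> ? [].
- by move=> _; split; [exact: measurableT | exact: approximableT].
- by apply/seteqP; split=> // t _; exists 0%N.
- by move=> A C [mA aA] [mC aC]; split; [exact: measurableI | exact: approximableI].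
- move=> A [mA [p [pp p1 pA]]].
  have e n : (\int[P]_u (p n (f u))%:E)%E = (\int[Q]_u (p n (h u))%:E)%E.
    have := moments_poly (pp n); rewrite /Rintegral.
    move=> /(congr1 (@EFin R)); rewrite !fineK //.
      apply: integrable_fin_num => //.
      exact: (bounded_mfun_integrable Q (bounded_mfun_poly mh (pp n))).
    apply: integrable_fin_num => //.
    exact: (bounded_mfun_integrable P (bounded_mfun_poly mf (pp n))).
  have cP := approximable_cvg (S := P) mf mA pp p1 pA.
  have cQ := approximable_cvg (S := Q) mh mA pp p1 pA.
  rewrite (_ : (fun n => _) = (fun n => \int[Q]_u (p n (h u))%:E)%E) in cP;
    last exact/funext.
  exact: (cvg_unique _ cP cQ).
- by move=> _; rewrite -ge0_fin_numE // fin_num_measure.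
- have : <<s @halfspaces R L >> `<=` <<s G >>.
    apply: smallest_sub; first exact: smallest_sigma_algebra.
    move=> A hA; apply: sub_sigma_algebra; split;
      last exact: approximable_halfspace.
    have [x [k [a ->]]] := hA; apply: sub_sigma_algebra.
    have /continuousP/(_ `]a, +oo[%classic) :=
      @coord_continuous R L (traces R L) x k.
    rewrite preimage_itvoy; apply; exact: interval_open.
  apply; move: mB; apply: smallest_sub; first exact: smallest_sigma_algebra.
  exact: open_Tr_halfspaces.
Qed.

End Moments.

(** * First moments of a Plancherel measure *)

Section PlancherelIntegral.
Variables (R : realType) (L : groupType).

Lemma fsum_seq (V : nmodType) (F : L -> V) (s : seq L) : uniq s ->
  (forall y, y \notin s -> F y = 0) ->
  \sum_(y \in [set: L]) F y = \sum_(y <- s) F y.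
Proof.
move=> us F0; apply: esym.
transitivity (\sum_(y \in [set` s]) F y); first exact: fsbig_seq.
apply: (fsbig_widen [set` s] [set: L]) => //.
by move=> y [_ /= /negP]; exact: F0.
Qed.

Lemma sum_delta (F : L -> R[i]) (s : seq L) (a : L) : uniq s -> a \in s ->
  \sum_(z <- s) (z == a)%:R * F z = F a.
Proof.
move=> us sa; rewrite (bigD1_seq a) //= eqxx mul1r big1 ?addr0 //.
by move=> z /negPf->; rewrite mul0r.
Qed.

Variables (c : R[i]) (x : L).
Hypothesis x1 : x != 1%g.

(** The element [delta_1 + c delta_x] of the group algebra. *)
Definition two_point (y : L) : R[i] := (y == 1%g)%:R + c * (y == x)%:R.

Lemma two_point_algebra : group_algebra two_point.
Proof.
apply: (@sub_finite_set _ _ [set` [:: 1%g; x]]); last exact: finite_seq.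
move=> y /=; apply: contraNT; rewrite !inE negb_or => /andP[/negPf y1 /negPf yx].
by rewrite /two_point y1 yx mulr0 addr0.
Qed.

Lemma two_point_l2 : (l2norm_sq two_point)%:C%C = 1 + c * c^*%C.
Proof.
rewrite /l2norm_sq (@fsum_seq _ _ [:: 1%g; x]) //=; last first.
- move=> y; rewrite !inE negb_or => /andP[/negPf y1 /negPf yx].
  by rewrite /two_point y1 yx mulr0 addr0 Normc.normc0 expr0n.
- by rewrite inE eq_sym x1.
rewrite !big_cons big_nil /two_point !eqxx (negPf x1) eq_sym (negPf x1).
rewrite mulr0 addr0 mulr1 add0r addr0 rmorphD !rmorphXn /=.
rewrite -sqr_normc; congr (_ + _ ^+ 2).
by rewrite expr1n expr0n addr0 sqrtr1 expr1n.
Qed.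

(** For [f = delta_1 + c delta_x], the adjoint of [f] convolved with [f] has the
    coefficient [1 + |c|^2] at [1], together with [c] at [x] and [conj c] at
    [x^-1]. *)
Lemma two_point_trace (t : L -> R[i]) : traces R L t ->
  complex.Re (lin_ext t (convolution (star two_point) two_point)) =
  l2norm_sq two_point + 2 * complex.Re (c * t x).
Proof.
move=> tt; have [_ _ t1] := tt.
(* [x] may be an involution, hence the removal of duplicates *)
pose s := undup [:: 1%g; x; x^-1%g].
have us : uniq s by exact: undup_uniq.
have shiftE z : two_point (x * z)%g = (z == x^-1%g)%:R + c * (z == 1%g)%:R.
  rewrite /two_point -(inj_eq (mulgI x) z x^-1%g) mulgV.
  by rewrite -(inj_eq (mulgI x) z 1%g) mulg1.
have convE z : convolution (star two_point) two_point z =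
    two_point z + c^*%C * two_point (x * z)%g.
  rewrite /convolution (@fsum_seq _ _ [:: 1%g; x^-1%g]) //=; last first.
  - move=> y; rewrite !inE negb_or => /andP[y1 yx].
    rewrite /star /two_point.
    by rewrite !eqg_invLR invg1 (negPf y1) (negPf yx) mulr0 addr0 rmorph0 mul0r.
  - by rewrite inE eq_sym invg_eq1 x1.
  rewrite !big_cons big_nil /star invg1 invgK mul1g addr0.
  rewrite [two_point 1%g]/two_point [two_point x]/two_point !eqxx (negPf x1).
  by rewrite eq_sym (negPf x1) mulr0 addr0 add0r mulr1 rmorph1 mul1r.
have -> : lin_ext t (convolution (star two_point) two_point) =
    (l2norm_sq two_point)%:C%C + (c * t x + (c * t x)^*%C).
  rewrite /lin_ext (@fsum_seq _ _ s us); last first.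
    move=> y; rewrite mem_undup !inE !negb_or => /and3P[/negPf y1 /negPf yx /negPf yV].
    by rewrite convE shiftE /two_point y1 yx yV !(mulr0, addr0) mul0r.
  under eq_bigr do rewrite convE shiftE /two_point.
  transitivity (\sum_(z <- s) (z == 1%g)%:R * t z
     + c * \sum_(z <- s) (z == x)%:R * t z
     + c^*%C * \sum_(z <- s) (z == x^-1%g)%:R * t z
     + c^*%C * c * \sum_(z <- s) (z == 1%g)%:R * t z).
    rewrite !mulr_sumr -!big_split /=; apply: eq_bigr => z _; ring.
  rewrite !sum_delta ?mem_undup ?inE ?eqxx ?orbT //.
  rewrite t1 (trace_inv _ tt) two_point_l2 rmorphM /=; ring.
rewrite addcJ; set r := complex.Re (c * t x).
have -> : 2%:R * r%:C%C = (2 * r)%:C%C by rewrite rmorphM rmorph_nat.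
by rewrite -rmorphD.
Qed.

End PlancherelIntegral.

Section PlancherelMoments.
Variables (R : realType) (L : groupType).
Variable mu : probability (borel (Ch R L)) R.

Lemma Ch_traces (t : Ch R L) : traces R L t.
Proof. exact: (set_mem (Ch_trace t)). Qed.

Lemma Ch_characters (t : Ch R L) : characters R L t.
Proof. exact: (set_mem (valP t)). Qed.

Lemma measurable_Ch_coord x k :
  measurable_fun setT (fun t : borel (Ch R L) => coordR k ((t : Ch R L) x)).
Proof.
apply: (@continuous_borel_measurable R (Ch R L) (fun t : Ch R L => coordR k (t x))).
exact: (@coord_continuous R L (characters R L)).
Qed.

Lemma bounded_mfunC_Ch x : bounded_mfunC (fun t : borel (Ch R L) => (t : Ch R L) x).
Proof.
split.
  split; first exact: (measurable_Ch_coord x (false, false)).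
  by exists 1 => u; exact: (trace_Re_bound _ (Ch_traces _)).
split; first exact: (measurable_Ch_coord x (true, false)).
by exists 1 => u; exact: (trace_Im_bound _ (Ch_traces _)).
Qed.

Hypothesis pl : plancherel_measure mu.

(** By [two_point_trace], the Plancherel formula for [delta_1 + c delta_x] says
    that the integral of [2 Re (c * t x)] is [0] when [x <> 1]. *)
Lemma Rintegral_plancherel c x :
  (\int[mu]_t complex.Re (c * (t : Ch R L) x))%R = complex.Re (c * (x == 1%g)%:R).
Proof.
have [->|x1] := eqVneq x 1%g.
  transitivity ((\int[mu]_t (cst (complex.Re c) t))%R).
    apply: eq_Rintegral => t _ /=.
    by have [_ _ ->] := Ch_traces t; rewrite mulr1.
  by rewrite Rintegral_cst // (congr1 fine (probability_setT mu)) /= !mulr1.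
have bc : bounded_mfun (fun t : borel (Ch R L) => complex.Re (c * (t : Ch R L) x)).
  by have [] := bounded_mfunCM (bounded_mfunC_cst _ c) (bounded_mfunC_Ch x).
have := pl (two_point_algebra c x).
set N := l2norm_sq _ => /(congr1 fine) /= e.
have : N = (\int[mu]_t (N + 2 * complex.Re (c * (t : Ch R L) x)))%R.
  rewrite {1}e; congr fine; apply: eq_integral => t _.
  by rewrite two_point_trace; [ | exact: x1 | exact: (Ch_traces t)].
rewrite RintegralD //; last 2 first.
- exact: (bounded_mfun_integrable mu (bounded_mfun_cst _ _)).
- exact: (bounded_mfun_integrable mu (bounded_mfunZ _ bc)).
rewrite RintegralZl //; last exact: (bounded_mfun_integrable mu bc).
rewrite Rintegral_cst // (congr1 fine (probability_setT mu)) /=.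
rewrite !mulr0 raddf0; lra.
Qed.

End PlancherelMoments.

(** * Plancherel measures and infinite conjugacy classes *)

Section InfiniteClasses.
Variables (R : realType) (G : groupType).

Definition normsq (z : R[i]) : R := complex.Re z ^+ 2 + complex.Im z ^+ 2.

(** The form of [t] is nonnegative at the points [1] and [y \in s] with the
    coefficients [- m * conj (t x)] and [1], where [m] is the size of [s]; this
    is a Cauchy-Schwarz inequality between [1] and the sum of [s]. *)
Lemma trace_normsq_le (t : G -> R[i]) (s : seq G) (x : G) :
  traces R G t -> (forall y, y \in s -> t y = t x) ->
  (size s)%:R ^+ 2 * normsq (t x) <=
  \sum_(y <- s) \sum_(z <- s) complex.Re (t (z^-1 * y)%g).
Proof.
move=> tt sx; have [pt _ t1] := tt.
set m := size s; set tau := t x.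
pose g (i : 'I_m.+1) := nth 1%g (1%g :: s) i.
pose c (i : 'I_m.+1) : R[i] := if val i == 0%N then - (m%:R * tau^*%C) else 1.
have gS (i : 'I_m) : g (lift ord0 i) \in s by exact: (mem_nth 1%g (ltn_ord i)).
have cS i : c (lift ord0 i) = 1 by [].
have c0 : c ord0 = - (m%:R * tau^*%C) by [].
have nthE (V : nmodType) (F : G -> V) :
    \sum_(i < m) F (g (lift ord0 i)) = \sum_(y <- s) F y.
  by rewrite (big_nth 1%g) big_mkord; apply: eq_bigr => i _.
have := pt _ g c.
rewrite big_ord_recl big_ord_recl.
have -> : g ord0 = 1%g by [].
rewrite c0.
have -> : \sum_(i < m) (- (m%:R * tau^*%C))^*%C *
      t ((g (lift ord0 i))^-1 * 1)%g * c (lift ord0 i) =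
      - (m%:R ^+ 2 * (tau * tau^*%C)).
  transitivity (\sum_(i < m) - (m%:R * (tau * tau^*%C))); last first.
    by rewrite sumr_const card_ord -mulr_natr; ring.
  apply: eq_bigr => i _; rewrite mulg1 (trace_inv _ tt) (sx _ (gS i)) -/tau.
  by rewrite cS mulr1 rmorphN rmorphM /= conjcK conjc_nat; ring.
have -> : \sum_(i < m) \sum_(j < m.+1) (c (lift ord0 i))^*%C *
      t ((g j)^-1 * g (lift ord0 i))%g * c j =
    - (m%:R ^+ 2 * (tau * tau^*%C)) + \sum_(y <- s) \sum_(z <- s) t (z^-1 * y)%g.
  under eq_bigr => i _.
    rewrite big_ord_recl.
    rewrite (_ : _ * c ord0 = - (m%:R * (tau * tau^*%C))); last first.
      rewrite invg1 mul1g (sx _ (gS i)) cS c0 -/tau rmorph1; ring.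
    over.
  rewrite big_split sumr_const card_ord -mulr_natr; congr (_ + _); first by ring.
  rewrite -nthE; apply: eq_bigr => i _; rewrite -nthE; apply: eq_bigr => j _.
  by rewrite !cS rmorph1 mul1r mulr1.
rewrite invg1 mul1g t1 mulr1 rmorphN rmorphM /= conjcK conjc_nat.
have -> : tau * tau^*%C = (normsq tau)%:C%C by rewrite -sqr_normc -add_Re2_Im2.
set S := \sum_(y <- s) _.
have -> : - (m%:R * tau) * - (m%:R * tau^*%C) = (m%:R ^+ 2 * normsq tau)%:C%C.
  rewrite rmorphM rmorphXn rmorph_nat /= add_Re2_Im2 sqr_normc; ring.
rewrite lecE => /andP[_].
have -> : m%:R ^+ 2 * (normsq tau)%:C%C = (m%:R ^+ 2 * normsq tau)%:C%C.
  by rewrite rmorphM rmorphXn rmorph_nat.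
rewrite !raddfD !raddfN /=.
have -> : complex.Re S = \sum_(y <- s) \sum_(z <- s) complex.Re (t (z^-1 * y)%g).
  by rewrite raddf_sum; apply: eq_bigr => y _; rewrite raddf_sum.
by lra.
Qed.

Variable mu : probability (borel (Ch R G)) R.
Hypothesis pl : plancherel_measure mu.

Lemma bounded_mfun_normsq (x : G) :
  bounded_mfun (fun t : borel (Ch R G) => normsq ((t : Ch R G) x)).
Proof.
have [bR bI] := bounded_mfunC_Ch R x.
rewrite /normsq; under eq_fun do rewrite !expr2.
by apply: bounded_mfunD; exact: bounded_mfunM.
Qed.

(** Take [n] distinct conjugates of [x] in [trace_normsq_le].  On the right only
    the [n] diagonal terms have a nonzero mean, so [n^2] times the integral is at
    most [n], for every [n]. *)
Lemma Rintegral_normsq (x : G) : x \notin fc G ->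
  (\int[mu]_t normsq ((t : Ch R G) x))%R = 0.
Proof.
move=> nx; set I := (LHS).
have I0 : 0 <= I by apply: Rintegral_ge0 => t _; rewrite addr_ge0 ?sqr_ge0.
have Iinf : infinite_set (conj_class x).
  by move=> fx; move/negP: nx; apply; exact/mem_set.
have bnd n : n%:R * I <= 1.
  have [-> //|n0] := eqVneq n 0%N; first by rewrite mul0r.
  have [B BC Bn] := infinite_set_fset n Iinf.
  have [s [us sz sC]] : exists s : seq G,
      [/\ uniq s, size s = n & forall y, y \in s -> conj_class x y].
    exists (take n B); split; first by rewrite take_uniq // fset_uniq.
      by rewrite size_takel.
    by move=> y /mem_take yB; exact: BC.
  have bR y : bounded_mfun (fun t : borel (Ch R G) => complex.Re ((t : Ch R G) y)).
    by have [] := bounded_mfunC_Ch R y.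
  have : n%:R ^+ 2 * I <= n%:R.
    rewrite -RintegralZl //;
      last exact: (bounded_mfun_integrable mu (bounded_mfun_normsq x)).
    apply: le_trans (_ : (\int[mu]_t (\sum_(y <- s) \sum_(z <- s)
        complex.Re ((t : Ch R G) (z^-1 * y)%g)))%R <= _).
      apply: le_Rintegral => //.
      - exact: (bounded_mfun_integrable mu (bounded_mfunZ _ (bounded_mfun_normsq x))).
      - apply: bounded_mfun_integrable; apply: bounded_mfun_sum => y.
        by apply: bounded_mfun_sum => z; exact: bR.
      - move=> t _; rewrite -sz; apply: trace_normsq_le; first exact: (Ch_traces t).
        move=> y /sC[g _ <-]; have [_ tc _] := Ch_traces t; exact: tc.
    rewrite Rintegral_bounded_mfun_sum; last first.
      by move=> y; apply: bounded_mfun_sum => z; exact: bR.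
    rewrite (eq_big_seq (fun=> 1)) ?big_const_seq.
      by rewrite count_predT iter_addr_0 sz.
    move=> y ys; rewrite Rintegral_bounded_mfun_sum; last by move=> z; exact: bR.
    transitivity (\sum_(z <- s) ((z == y)%:R : R)).
      apply: eq_bigr => z _; have := Rintegral_plancherel pl 1 (z^-1 * y)%g.
      rewrite mul1r => e.
      transitivity ((\int[mu]_t complex.Re (1 * (t : Ch R G) (z^-1 * y)%g))%R).
        by apply: eq_Rintegral => t _; rewrite mul1r.
      rewrite e -(inj_eq (mulgI z)) mulVKg mulg1 eq_sym.
      by case: (_ == _).
    rewrite (bigD1_seq y) //= eqxx big1 ?addr0 // => z /negPf -> //.
  have n0' : 0 < n%:R :> R by rewrite ltr0n lt0n.
  by rewrite expr2 -mulrA -[X in _ <= X]mulr1 ler_pM2l.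
apply/eqP; rewrite eq_le I0 andbT leNgt; apply/negP => Ip.
have : I^-1 < (Num.bound I^-1)%:R by rewrite archi_boundP // invr_ge0.
by rewrite -div1r ltr_pdivrMr // ltNge bnd.
Qed.

(** The integrand [r] satisfies [r^2 <= |c|^2 |t x|^2], whose integral is [0], and
    [|r| <= r^2 / e + e] for every [e > 0]. *)
Lemma Rintegral_word_out (c : R[i]) (w : seq G) (x : G) :
  x \in w -> x \notin fc G ->
  (\int[mu]_t complex.Re (c * word_val (t : Ch R G) w))%R = 0.
Proof.
move=> xw nx; have nI := Rintegral_normsq nx.
have bW : bounded_mfun
    (fun t : borel (Ch R G) => complex.Re (c * word_val (t : Ch R G) w)).
  have bw := bounded_mfunC_prod w (fun y => bounded_mfunC_Ch R y).
  by have [] := bounded_mfunCM (bounded_mfunC_cst _ c) bw.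
have bd e (t : Ch R G) : 0 < e ->
    `|complex.Re (c * word_val t w)| <= (e^-1 * normsq c) * normsq (t x) + e.
  move=> e0; set r := complex.Re _.
  have normsqM a b : normsq (a * b) = normsq a * normsq b.
    by case: a => a a'; case: b => b b'; rewrite /normsq /=; ring.
  have normsq1 y : normsq (t y) <= 1 by apply: trace_sqr_le1; exact: Ch_traces.
  have normsq_ge0 a : 0 <= normsq a by rewrite addr_ge0 ?sqr_ge0.
  have wx : normsq (word_val t w) <= normsq (t x).
    elim: (w) xw => // y v IHv; rewrite inE /word_val big_cons normsqM.
    have v1 : normsq (\prod_(z <- v) t z) <= 1.
      elim: v {IHv} => [|z v IHv]; first by rewrite big_nil /normsq /=; lra.
      by rewrite big_cons normsqM mulr_ile1.
    case/orP => [/eqP <-|xv]; first by rewrite ler_piMr.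
    apply: le_trans (IHv xv); rewrite ler_piMl //.
  have r2 : r ^+ 2 <= normsq c * normsq (t x).
    apply: le_trans (_ : normsq (c * word_val t w) <= _).
      by rewrite /normsq lerDl sqr_ge0.
    by rewrite normsqM ler_wpM2l.
  apply: le_trans (_ : e^-1 * r ^+ 2 + e <= _); last first.
    by rewrite lerD2r -mulrA ler_wpM2l // invr_ge0 ltW.
  rewrite -(ler_pM2l e0) mulrDr mulrA divff ?gt_eqF // mul1r.
  rewrite -[r ^+ 2]real_normK ?num_real //.
  have := sqr_ge0 (`|r| - e); have := normr_ge0 r; nra.
have bI e : 0 < e ->
    `|(\int[mu]_t complex.Re (c * word_val (t : Ch R G) w))%R| <= e.
  move=> e0; apply: le_trans (le_normr_Rintegral _ _) _ => //.
    exact: (bounded_mfun_integrable mu bW).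
  have bN : bounded_mfun (fun t : borel (Ch R G) =>
      (e^-1 * normsq c) * normsq ((t : Ch R G) x)).
    exact: bounded_mfunZ (bounded_mfun_normsq x).
  apply: le_trans (_ : (\int[mu]_t ((e^-1 * normsq c) *
      normsq ((t : Ch R G) x) + e))%R <= _).
    apply: le_Rintegral => //.
    - apply: bounded_mfun_integrable; case: bW => mW [M bM]; split.
        exact: measurableT_comp.
      by exists M => t; rewrite normr_id.
    - exact: (bounded_mfun_integrable mu (bounded_mfunD bN (bounded_mfun_cst _ e))).
    - by move=> t _; exact: bd.
  rewrite RintegralD //; last 2 first.
  - exact: (bounded_mfun_integrable mu bN).
  - exact: (bounded_mfun_integrable mu (bounded_mfun_cst _ e)).
  rewrite RintegralZl //;
      last exact: (bounded_mfun_integrable mu (bounded_mfun_normsq x)).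
  rewrite nI mulr0 add0r Rintegral_cst //.
  by rewrite (congr1 fine (probability_setT mu)) /= mulr1.
apply/eqP; rewrite -normr_le0 leNgt; apply/negP => h.
have := bI _ (divr_gt0 h (ltr0n _ 2)); set n := `|_| in h *.
by rewrite leNgt ltr_pdivrMr // ltr_pMr // ltr1n.
Qed.

End InfiniteClasses.

(** * Comparison of the moments *)

Section ProductLists.

(** The terms of the expanded product, in the group algebra, of the sums of the
    given lists. *)
Fixpoint prod_lists (L : groupType) (uss : seq (seq L)) : seq L :=
  if uss is us :: uss' then [seq (a * b)%g | a <- us, b <- prod_lists uss']
  else [:: 1%g].

Lemma character_prod_lists (R : realType) (L : groupType) (t : L -> R[i])
    (uss : seq (seq L)) :
  characters R L t -> (forall us, us \in uss -> conj_stable us) ->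
  \sum_(v <- prod_lists uss) t v = \prod_(us <- uss) \sum_(a <- us) t a.
Proof.
move=> ch; have [[_ _ t1] _] := ch.
elim: uss => [_|us uss IH st] /=; first by rewrite big_seq1 big_nil.
rewrite big_cons -IH => [|vs vsu]; last by apply: st; rewrite inE vsu orbT.
rewrite big_allpairs_dep exchange_big mulr_sumr; apply: eq_bigr => b _.
by rewrite character_central //; apply: st; rewrite mem_head.
Qed.

Lemma map_prod_lists (L M : groupType) (f : L -> M) (uss : seq (seq L)) :
  f 1%g = 1%g -> {morph f : x y / (x * y)%g} ->
  prod_lists (map (map f) uss) = map f (prod_lists uss).
Proof.
move=> f1 fM; elim: uss => [|us uss IH] /=; first by rewrite f1.
rewrite IH map_allpairs allpairs_mapl allpairs_mapr.
by apply: eq_allpairs => // a b; rewrite fM.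
Qed.

(** By multiplicativity of characters the integrand is [c] times the value of [t]
    at the product of the sums of the lists; the mean of this value is the
    coefficient of [1] in that product. *)
Lemma Rintegral_prod_lists (R : realType) (L : groupType)
    (mu : probability (borel (Ch R L)) R) (c : R[i]) (uss : seq (seq L)) :
  plancherel_measure mu -> (forall us, us \in uss -> conj_stable us) ->
  (\int[mu]_t complex.Re
     (c * \prod_(us <- uss) \sum_(a <- us) (t : Ch R L) a))%R =
  \sum_(v <- prod_lists uss) complex.Re (c * (v == 1%g)%:R).
Proof.
move=> pl st.
rewrite (eq_bigr (fun v =>
    (\int[mu]_t complex.Re (c * (t : Ch R L) v))%R)); last first.
  by move=> v _; rewrite Rintegral_plancherel.
rewrite -Rintegral_bounded_mfun_sum; last first.
  by move=> v; have [] := bounded_mfunCM (bounded_mfunC_cst _ c) (bounded_mfunC_Ch R v).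
apply: eq_Rintegral => t _.
by rewrite -(character_prod_lists (Ch_characters t) st) mulr_sumr raddf_sum.
Qed.

End ProductLists.

Section PhiMap.
Variables (R : realType) (G : groupType).
Hypothesis finA : finite_set (AdG G).
Let L := fc_center G.

Definition Phi_map (t : Ch R L) : Tr R G :=
  SigSub (mem_set (Phi_fun_trace finA (Ch_traces t))
    : (Phi_fun t : {ptws G -> R[i]^o}) \in traces R G).

Lemma Phi_mapE t x : Phi_map t x = Phi_fun t x. Proof. by []. Qed.

Lemma bounded_mfunC_Phi x : bounded_mfunC (fun t : borel (Ch R L) => Phi_map t x).
Proof.
have [xF|xF] := boolP (x \in fc G); last first.
  rewrite (_ : (fun t => _) = (fun=> 0)); first exact: bounded_mfunC_cst.
  by apply/funext => t; rewrite Phi_mapE Phi_fun_out.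
rewrite (_ : (fun t => _) =
  (fun t : borel (Ch R L) => (size (Ad_seq G))%:R^-1 *
     \sum_(z <- Ad_orbit (Sub x xF : L)) (t : Ch R L) z)).
  apply: bounded_mfunCM; first exact: bounded_mfunC_cst.
  by apply: bounded_mfunC_sum => z; exact: bounded_mfunC_Ch.
apply/funext => t; exact: (Phi_fun_in finA (t : Ch R L) (Sub x xF : L)).
Qed.

Lemma measurable_coordR d (X : measurableType d) (F : X -> R[i]) k :
  bounded_mfunC F -> measurable_fun setT (fun u => coordR k (F u)).
Proof.
move=> [bR bI]; case: k => -[] []; rewrite /coordR /=.
- by have [] := bounded_mfunN bI.
- by have [] := bI.
- by have [] := bounded_mfunN bR.
- by have [] := bR.
Qed.

Lemma fc_orbit_stable (y : L) : conj_stable (Ad_orbit y).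
Proof.
move=> g; rewrite -[X in perm_eq X _]
  (_ : [seq Ad (val g)^-1%g z | z <- Ad_orbit y] = _).
  exact: map_Ad_orbit.
by apply: eq_map => z; apply: val_inj; rewrite /= invgK mulgA.
Qed.

Lemma orbit_stable (y : L) : conj_stable [seq val z | z <- Ad_orbit y].
Proof.
move=> g; rewrite -map_comp.
rewrite -[X in perm_eq X _]
  (_ : [seq val z | z <- [seq Ad g^-1%g z | z <- Ad_orbit y]] = _).
  by apply: perm_map; exact: map_Ad_orbit.
by rewrite -map_comp; apply: eq_map => z; rewrite /= conjgE invgK mulgA.
Qed.

Variables (mu_fc : probability (borel (Ch R L)) R).
Variables (mu : probability (borel (Ch R G)) R).
Hypotheses (pl_fc : plancherel_measure mu_fc) (pl : plancherel_measure mu).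

(** If a letter of [w] is outside the FC-center, both sides vanish.  Otherwise
    both integrands are [N ^- size w] times a product of sums over the orbits of
    the letters, with [N] the order of [Ad(G)], and both integrals count the ways
    of writing [1] as a product of points of these orbits: in [G] on one side, in
    the FC-center on the other. *)
Lemma Plancherel_Phi_moments (c : R[i]) (w : seq G) :
  (\int[mu]_t complex.Re (c * word_val (Ch_Tr (t : Ch R G)) w))%R =
  (\int[mu_fc]_t complex.Re (c * word_val (Phi_map t) w))%R.
Proof.
have N0 := size_Ad_seq_neq0 R finA; set N := (size _)%:R in N0.
have [/allP wF|] := boolP (all (fun x => x \in fc G) w); last first.
  move=> /allPn[x xw nx]; rewrite (Rintegral_word_out pl c xw nx).
  apply/esym; transitivity ((\int[mu_fc]_t (cst (0 : R) t))%R).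
    apply: eq_Rintegral => t _; rewrite /word_val (big_rem x) //=.
    by rewrite Phi_mapE Phi_fun_out // mul0r mulr0.
  by rewrite Rintegral_cst // mul0r.
pose y (x : G) : L := insubd 1%g x.
have yK x : x \in w -> val (y x) = x by move=> /wF xF; rewrite insubdK.
pose uss := [seq Ad_orbit (y x) | x <- w].
have -> : (\int[mu]_t complex.Re (c * word_val (Ch_Tr (t : Ch R G)) w))%R =
    (\int[mu]_t complex.Re (c * N ^- size w *
       \prod_(us <- [seq map val us | us <- uss]) \sum_(a <- us) (t : Ch R G) a))%R.
  apply: eq_Rintegral => t _; congr complex.Re; rewrite -mulrA; congr (_ * _).
  rewrite -map_comp big_map /=.
  have -> : \prod_(x <- w) \sum_(a <- [seq val z | z <- Ad_orbit (y x)]) (t : Ch R G) a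
     = \prod_(x <- w) (N * (t : Ch R G) x).
    rewrite big_seq [RHS]big_seq; apply: eq_bigr => x xw.
    rewrite /Ad_orbit !big_map (eq_big_seq (fun=> (t : Ch R G) x)).
      by rewrite big_const_seq count_predT iter_addr_0 mulr_natl.
    move=> s; rewrite mem_Ad_seq // => /set_mem[g _ <-].
    have [_ tc _] := Ch_traces t.
    by rewrite /= yK // -[RHS](tc x g^-1%g) conjgE invgK mulgA.
  rewrite big_split /= big_const_seq count_predT iter_mulr_1 mulrA.
  by rewrite mulVf ?mul1r // expf_neq0.
have -> : (\int[mu_fc]_t complex.Re (c * word_val (Phi_map t) w))%R =
    (\int[mu_fc]_t complex.Re (c * N ^- size w *
       \prod_(us <- uss) \sum_(a <- us) (t : Ch R L) a))%R.
  apply: eq_Rintegral => t _; congr complex.Re; rewrite -mulrA; congr (_ * _).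
  rewrite big_map /word_val.
  have -> : \prod_(x <- w) Phi_map t x =
      \prod_(x <- w) (N^-1 * \sum_(a <- Ad_orbit (y x)) (t : Ch R L) a).
    rewrite big_seq [RHS]big_seq; apply: eq_bigr => x xw.
    by rewrite Phi_mapE -[in LHS](yK x xw) Phi_fun_in.
  by rewrite big_split /= big_const_seq count_predT iter_mulr_1 exprVn.
rewrite !Rintegral_prod_lists //; last 2 first.
- by move=> _ /mapP[x _ ->]; exact: fc_orbit_stable.
- by move=> _ /mapP[_ /mapP[x _ ->] ->]; exact: orbit_stable.
rewrite map_prod_lists // big_map; apply: eq_bigr => v _.
by rewrite -[1%g in LHS]/(val (1%g : L)) (inj_eq val_inj).
Qed.

End PhiMap.

Theorem corollary3 (R : realType) (G : groupType)
    (countG : countable [set: G]) (linG : linear_group G) :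
  [/\ central_group (fc_center G),
      [/\ KG G = AdG G, group_closed (fun s => s \in KG G)
        & finite_set (KG G)]
    & exists Phi : borel (Ch R (fc_center G)) -> borel (Tr R G),
      [/\ forall (t : Ch R (fc_center G)) (x : G),
            (Phi t : Tr R G) x = Phi_fun t x,
          measurable_fun setT Phi
        & forall (mu_fc : probability (borel (Ch R (fc_center G))) R)
                 (mu : probability (borel (Ch R G)) R),
            plancherel_measure mu_fc -> plancherel_measure mu ->
            forall B : set (borel (Tr R G)), measurable B ->
              pushforward mu (@Ch_Tr R G : _ -> borel (Tr R G)) B
              = pushforward mu_fc Phi B]].
Proof.
have finA := linear_finite_AdG linG.
have mPhi x k : measurable_fun setT
    (fun t : borel (Ch R (fc_center G)) => coordR k (Phi_map finA t x)).
  by apply: measurable_coordR; exact: bounded_mfunC_Phi.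
have mCh x k : measurable_fun setT
    (fun t : borel (Ch R G) => coordR k (Ch_Tr (t : Ch R G) x)).
  exact: measurable_Ch_coord.
split; first exact: central_fc_center.
  rewrite KG_finite //; split=> //; exact: AdG_group_closed.
exists (Phi_map finA); split=> //; first exact: measurable_fun_Tr.
move=> mu_fc mu pl_fc pl B mB.
exact: (eq_of_moments countG mCh mPhi (Plancherel_Phi_moments finA pl_fc pl) mB).
Qed.
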